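(* Let $n\ge 2$ and let $M\subset\mathbb{C}^{n+1}$ be a formal submanifold defined by $w=|z|^2+E(z,\bar z)$, where $E$ is a formal power series in $(z,\bar z)$ with $Ord(E)\ge 3$. Then there exists a unique formal transformation $$z'=F=z+f(z,w),\qquad w'=G=w+g(z,w),\qquad Ord_{wt}(f)\ge 2,\ Ord_{wt}(g)\ge 3,$$ satisfying the normalization $$\begin{cases} f_{i,(0)}(u)=0, & 1\le i\le n;\\ f_{i,(e_j)}(u)=0, & 1\le j<i\le n;\\ f_{1,(e_1)}(u)=0,\quad \mathrm{Im}\,(f_{i,(e_i)}(u))=0, & 2\le i\le n,\end{cases}$$ that transforms $M$ to a formal submanifold defined by $$w'=|z'|^2+\varphi(z',\overline{z'}),\qquad \varphi=O(|z'|^3),$$ such that, in the unique expansion $$\varphi=\sum_{i_l j_l=0,\ l=1,\dots,n}\varphi_{(I,J)}^{(K)}z^I\bar z^J u^{k_1}v_2^{k_2}\cdots v_n^{k_n}$$ (written here with the variable $z$ in place of $z'$), the following holds for all integers $k\ge 0$, $l\ge 1$, $\tau\ge 2$: $$\begin{cases}\varphi_{(0,0)}^{(\tau e_1)}=0;\\ \mathrm{Re}(\varphi_{(0,0)}^{(le_1+e_i)})=0 & \text{for } 2\le i\le n;\\ \varphi_{(e_i,e_j)}^{(le_1)}=0 & \text{for } i>j;\\ \varphi_{(I,0)}^{(le_1)}=\varphi_{(0,I)}^{(le_1)}=\varphi_{(0,I)}^{(ke_1+e_j)}=0 & \text{for } |I|\ge 1,\ 2\le j\le n;\\ \varphi_{(I,e_h)}^{(ke_1)}=0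 & \text{for } h\ge 1,\ |I|\ge 2,\ i_h=0;\\ \varphi_{(0,I)}^{(0)}=\overline{\varphi_{(I,0)}^{(0)}} & \text{for } |I|>2.\end{cases}$$
   Context: Coordinates of $\mathbb{C}^{n+1}$ are $(z,w)=(z_1,\dots,z_n,w)$. For a formal power series $E(z,\bar z)$ without constant term, $Ord(E)\ge k$ (also written $E=O(|z|^k)$) means $E(tz,t\bar z)=O(t^k)$. For a formal power series $h(z,w)$ without constant term, $Ord_{wt}(h)\ge k$ means $h(tz,t^2w)=O(t^k)$ (weight $1$ for $z$, weight $2$ for $w$); for vectors this is meant componentwise. For $f=(f_1,\dots,f_n)$ write $f_i(z,w)=\sum_I f_{i,(I)}(w)z^I$ with $I=(i_1,\dots,i_n)$ a multi-index of nonnegative integers, $z^I=z_1^{i_1}\cdots z_n^{i_n}$, $|I|=i_1+\cdots+i_n$; $f_{i,(I)}(u)$ denotes this power series evaluated at a real variable $u$, so $\mathrm{Im}(f_{i,(e_i)}(u))=0$ means that all its coefficients are real. $e_j\in\mathbb{Z}^n$ is the vector with $1$ in position $j$ and $0$ elsewhere. Set $u=\sum_{i=1}^n|z_i|^2$ and $v_k=\sum_{i=1}^{k-1}|z_i|^2-|z_k|^2$ for $2\le k\le n$. Every formal power series $\varphi(z,\bar z)$ without constant term has a unique expansion $\varphi=\sum \varphi_{(I,J)}^{(K)}z^I\bar z^Ju^{k_1}v_2^{k_2}\cdots v_n^{k_n}$ over multi-indices $I,J,K=(k_1,\dots,k_n)$ of nonnegative integers with $i_lj_l=0$ for all $l=1,\dots,n$;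 here $\bar z^J=\bar z_1^{j_1}\cdots\bar z_n^{j_n}$. The formal map $(F,G)$ transforms $M$ to $\{w'=|z'|^2+\varphi(z',\overline{z'})\}$ if $G=\sum_i F_i\overline{F_i}+\varphi(F,\overline F)$ as formal power series in $(z,\bar z)$ after substituting $w=|z|^2+E(z,\bar z)$. *)

(* Defs.v *)
From mathcomp Require Import all_boot all_order all_algebra.
From mathcomp Require Import reals complex.
From mathcomp Require Import mpoly.

Set Implicit Arguments.
Unset Strict Implicit.
Unset Printing Implicit Defensive.

Import GRing.Theory Num.Theory.
Local Open Scope ring_scope.

(* A formal power series in N variables is its family of coefficients. *)
Definition fps (K : Type) (N : nat) : Type := 'X_{1..N} -> K.

Section Series.

Variables (K : comNzRingType) (N : nat).
Implicit Types a b : fps K N.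

Definition fps_zero : fps K N := fun _ => 0.

Definition fps_one : fps K N := fun m => (m == 0%MM)%:R.

Definition fps_var (i : 'I_N) : fps K N := fun m => (m == U_(i)%MM)%:R.

Definition fps_add a b : fps K N := fun m => a m + b m.

Definition fps_sub a b : fps K N := fun m => a m - b m.

(* Same convolution as [mcoeffM] for polynomials: m = k.1 + k.2 forces both
   degrees to be at most [mdeg m]. *)
Definition fps_mul a b : fps K N := fun m =>
  \sum_(k : 'X_{1..N < (mdeg m).+1, (mdeg m).+1} | m == (k.1 + k.2)%MM)
    (a k.1 * b k.2).

Definition fps_pow a (k : nat) : fps K N := iter k (fps_mul a) fps_one.

Definition fps_sum (n : nat) (P : pred 'I_n) (a : 'I_n -> fps K N) : fps K N :=
  \big[fps_add/fps_zero]_(i < n | P i) a i.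

(* g^I = g_1^{i_1} ... g_p^{i_p} *)
Definition fps_monom (p : nat) (g : 'I_p -> fps K N) (I : 'X_{1..p}) :
    fps K N :=
  \big[fps_mul/fps_one]_(i < p) fps_pow (g i) (I i).

(* Substitution h(g_1, ..., g_p) = sum_I h_I g^I, meaningful when the g_i have
   no constant term: then g^I has order at least |I|, so only the I with
   |I| <= |m| contribute to the coefficient of index m. *)
Definition fps_comp (p : nat) (h : fps K p) (g : 'I_p -> fps K N) : fps K N :=
  fun m => \sum_(I : 'X_{1..p < (mdeg m).+1}) h I * fps_monom g I m.

(* In particular a has no constant term as soon as d > 0. *)
Definition Ord_ge a (d : nat) : Prop :=
  forall m : 'X_{1..N}, (mdeg m < d)%N -> a m = 0.

End Series.

Arguments fps_one {K N}.
Arguments fps_var {K N} i.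

Declare Scope fps_scope.
Delimit Scope fps_scope with F.
Notation "a + b" := (fps_add a b) : fps_scope.
Notation "a - b" := (fps_sub a b) : fps_scope.
Notation "a * b" := (fps_mul a b) : fps_scope.

Definition mnm_cat (n p : nat) (I : 'X_{1..n}) (J : 'X_{1..p}) :
    'X_{1..n + p} :=
  [multinom match split i with inl a => I a | inr b => J b end | i < n + p].

Definition glue (A : Type) (n p : nat) (x : 'I_n -> A) (y : 'I_p -> A) :
    'I_(n + p) -> A :=
  fun i => match split i with inl a => x a | inr b => y b end.

(* A series in (z, w) has n + 1 variables, w being the last one. *)
Definition zw_coef (K : Type) (n : nat) (h : fps K (n + 1)) (I : 'X_{1..n})
    (k : nat) : K :=
  h (mnm_cat I [multinom k | i < 1]).

Definition Ord_wt_ge (K : comNzRingType) (n : nat) (h : fps K (n + 1))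
    (d : nat) : Prop :=
  forall (I : 'X_{1..n}) (k : nat), (mdeg I + 2 * k < d)%N -> zw_coef h I k = 0.

Section Submanifolds.

Variables (R : realType) (n : nat).

(* A series in (z, \bar z) has n + n variables: first the z_i, then the
   \bar z_i. *)
Definition zv (i : 'I_n) : fps R[i] (n + n) := fps_var (lshift n i).

Definition zbarv (i : 'I_n) : fps R[i] (n + n) := fps_var (rshift n i).

(* Complex conjugation: the coefficient of z^I \bar z^J in the conjugate is the
   conjugate of the coefficient of z^J \bar z^I. *)
Definition fps_conj (a : fps R[i] (n + n)) : fps R[i] (n + n) := fun m =>
  (a (mnm_cat [multinom m (rshift n i) | i < n]
              [multinom m (lshift n i) | i < n]))^*.

Definition sqmod (i : 'I_n) : fps R[i] (n + n) := (zv i * zbarv i)%F.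

Definition sqnorm : fps R[i] (n + n) := fps_sum predT sqmod.

(* h(z, |z|^2 + E(z, \bar z)) *)
Definition restrict_to (E : fps R[i] (n + n)) (h : fps R[i] (n + 1)) :
    fps R[i] (n + n) :=
  fps_comp h (glue zv (fun _ : 'I_1 => (sqnorm + E)%F)).

(* (F, G) transforms {w = |z|^2 + E} to {w' = |z'|^2 + phi}. *)
Definition transforms (E : fps R[i] (n + n)) (F : 'I_n -> fps R[i] (n + 1))
    (G : fps R[i] (n + 1)) (phi : fps R[i] (n + n)) : Prop :=
  let FM i := restrict_to E (F i) in
  let FMbar i := fps_conj (FM i) in
  restrict_to E G =
    (fps_sum predT (fun i => FM i * FMbar i) + fps_comp phi (glue FM FMbar))%F.

(* The coordinates 1, ..., n are indexed by the ordinals 0, ..., n - 1, so a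
   condition "2 <= i" reads (0 < i)%N. *)

Definition e1 : 'X_{1..n} := [multinom (i == 0%N :> nat) : nat | i < n].

(* The n-tuple (u, v_2, ..., v_n). *)
Definition uv (k : 'I_n) : fps R[i] (n + n) :=
  if k == 0%N :> nat then sqnorm
  else (fps_sum (fun i : 'I_n => (i < k)%N) sqmod - sqmod k)%F.

(* phi = sum of c I J K z^I \bar z^J u^{k_1} v_2^{k_2} ... v_n^{k_n} over the
   I, J, K with i_l j_l = 0 for all l.  The summand of index (I, J, K) is
   homogeneous of degree |I| + |J| + 2|K|, so the coefficient of index m only
   involves indices with |I|, |J|, |K| <= |m|. *)
Definition is_uv_expansion (phi : fps R[i] (n + n))
    (c : 'X_{1..n} -> 'X_{1..n} -> 'X_{1..n} -> R[i]) : Prop :=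
  (forall I J K : 'X_{1..n}, (exists l : 'I_n, (I l * J l)%N <> 0%N) -> c I J K = 0) /\
  (forall m : 'X_{1..n + n}, phi m =
     \sum_(I : 'X_{1..n < (mdeg m).+1})
      \sum_(J : 'X_{1..n < (mdeg m).+1})
       \sum_(K : 'X_{1..n < (mdeg m).+1})
         c I J K *
         (fps_monom zv I * fps_monom zbarv J * fps_monom uv K)%F m).

Definition normalized_map (f : 'I_n -> fps R[i] (n + 1)) : Prop :=
  [/\ forall (i : 'I_n) k, zw_coef (f i) 0%MM k = 0,
      forall (i j : 'I_n) k, (j < i)%N -> zw_coef (f i) U_(j)%MM k = 0,
      forall (i : 'I_n) k, i = 0%N :> nat -> zw_coef (f i) U_(i)%MM k = 0
    & forall (i : 'I_n) k, (0 < i)%N -> 'Im (zw_coef (f i) U_(i)%MM k) = 0].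

Definition normal_form (c : 'X_{1..n} -> 'X_{1..n} -> 'X_{1..n} -> R[i]) :
    Prop :=
  (forall t, (2 <= t)%N -> c 0%MM 0%MM (e1 *+ t)%MM = 0) /\
  (forall l (i : 'I_n), (1 <= l)%N -> (0 < i)%N ->
     'Re (c 0%MM 0%MM (e1 *+ l + U_(i))%MM) = 0) /\
  (forall l (i j : 'I_n), (1 <= l)%N -> (j < i)%N ->
     c U_(i)%MM U_(j)%MM (e1 *+ l)%MM = 0) /\
  (forall I : 'X_{1..n}, (1 <= mdeg I)%N ->
     [/\ forall l, (1 <= l)%N -> c I 0%MM (e1 *+ l)%MM = 0,
         forall l, (1 <= l)%N -> c 0%MM I (e1 *+ l)%MM = 0
       & forall k (j : 'I_n), (0 < j)%N ->
           c 0%MM I (e1 *+ k + U_(j))%MM = 0]) /\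
  (forall k (I : 'X_{1..n}) (h : 'I_n), (2 <= mdeg I)%N -> I h = 0%N ->
     c I U_(h)%MM (e1 *+ k)%MM = 0) /\
  (forall I : 'X_{1..n}, (2 < mdeg I)%N ->
     c 0%MM I 0%MM = (c I 0%MM 0%MM)^*).

End Submanifolds.

(* Main.v *)
(* Give z weight 1 and w weight 2.  If two triples (f, g, phi) agree below weight d
   (d - 1 for f), then the weight d part of the difference of the two
   transformation equations is linear:
     g(z, |z|^2) - 2 Re (sum_i f_i(z, |z|^2) \bar z_i) - phi(z, \bar z).
   It therefore suffices to show that this linear map is a bijection from
   normalized triples onto series of order at least 3; the solution is then
   built, and shown unique, one weight at a time.
   For the linear problem, the terms z^I \bar z^J q(|z_1|^2, ..., |z_n|^2) with
   I, J of disjoint support decouple, and in each of them |z_1|^2, ..., |z_n|^2 are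
   replaced by the invertible linear forms u, v_2, ..., v_n.  The conditions on
   phi then give f_{h,(I)} with I_h = 0 from the (I, e_h) term, f_{i,(I + e_i)}
   from the n coefficients u^{k+1}, u^k v_j of the (0, I) term, g_(I) from the (I, 0)
   term, and the real series f_{i,(e_i)} from the (0, 0) term. *)

From HB Require Import structures.
Require Import Defs.
From mathcomp Require Import all_boot all_order all_algebra.
From mathcomp Require Import reals complex.
From mathcomp Require Import mpoly.
From mathcomp Require Import boolp zify ring.
Import GRing.Theory Num.Theory.
Set Implicit Arguments.
Unset Strict Implicit.
Unset Printing Implicit Defensive.
Local Open Scope ring_scope.

(** * The ring of formal power series *)

(** The lower bounds on l, tau and |I| in the normal form cost nothing: an equation of the linear
    system that they leave out has weight at most 2, where both sides vanish. The full system is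
    triangular: [f] first, then [g] from [f]. Two slots shape it. In the (0, 0) slice the
    coefficient of u^{k+1} is spent on [g], so only n - 1 equations remain for the n real unknowns
    f_{i,(e_i)}; the condition f_{1,(e_1)} = 0 replaces the missing one. The coefficient of \bar z^I
    free of u and v is out of reach of [f] and [g]: since f_{i,(0)} = 0, every contribution to the
    (0, I) slice carries a factor |z_i|^2. It can only be tied to the coefficient of z^I, and this
    fixes g_(I)(0). The nonlinear terms stay out of the way because [f] has weight at least 2 and
    [phi] order at least 3: a change of [f] in weight d - 1 then affects them only from order d + 1
    on. *)

Section SeriesRing.
Variables (K : comNzRingType) (N : nat).
Implicit Types (a b c : fps K N) (p q : {mpoly K[N]}).

(* Ring identities for series are transported from polynomials through truncation. *)
Definition eq_upto d p a := forall m, (mdeg m <= d)%N -> p@_m = a m.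

Definition fps_trunc d a : {mpoly K[N]} :=
  \sum_(m : 'X_{1..N < d.+1}) a m *: 'X_[m].

Lemma fps_truncP d a : eq_upto d (fps_trunc d a) a.
Proof.
move=> m hm; have hm' : (mdeg m < d.+1)%N by [].
rewrite /fps_trunc raddf_sum /= (bigD1 (BMultinom hm')) //= big1 ?addr0.
  by rewrite mcoeffZ mcoeffX eqxx mulr1.
by move=> i; rewrite bmeqP /= => /negbTE ne; rewrite mcoeffZ mcoeffX ne mulr0.
Qed.

Lemma eq_uptoM d p q a b :
  eq_upto d p a -> eq_upto d q b -> eq_upto d (p * q) (fps_mul a b).
Proof.
move=> hp hq m hm; rewrite mcoeffM; apply: eq_bigr => k _.
by congr (_ * _); [apply: hp | apply: hq]; apply: leq_trans hm;
  rewrite -ltnS; apply: bmdeg.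
Qed.

Lemma eq_upto_fps d p q a b :
  p = q -> eq_upto d p a -> eq_upto d q b -> forall m, (mdeg m <= d)%N -> a m = b m.
Proof. by move=> -> ha hb m hm; rewrite -ha // hb. Qed.

Lemma fps_mulA : associative (@fps_mul K N).
Proof.
move=> a b c; apply/funext => m; have h x := @fps_truncP (mdeg m) x.
apply: (eq_upto_fps (mulrA _ _ _) (eq_uptoM (h a) (eq_uptoM (h b) (h c)))
          (eq_uptoM (eq_uptoM (h a) (h b)) (h c))) => //.
Qed.

Lemma fps_mulC : commutative (@fps_mul K N).
Proof.
move=> a b; apply/funext => m; have h x := @fps_truncP (mdeg m) x.
exact: (eq_upto_fps (mulrC _ _) (eq_uptoM (h a) (h b)) (eq_uptoM (h b) (h a))).
Qed.

Lemma eq_upto1 d : eq_upto d 1 fps_one.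
Proof. by move=> m _; rewrite mcoeff1. Qed.

Lemma fps_mul1 : left_id fps_one (@fps_mul K N).
Proof.
move=> a; apply/funext => m; have h x := @fps_truncP (mdeg m) x.
exact: (eq_upto_fps (mul1r _) (eq_uptoM (@eq_upto1 _) (h a)) (h a)).
Qed.

Lemma fps_mulDl : left_distributive (@fps_mul K N) (@fps_add K N).
Proof.
move=> a b c; apply/funext => m; rewrite /fps_mul /fps_add -big_split /=.
by apply: eq_bigr => k _; rewrite mulrDl.
Qed.

Definition fps_opp a : fps K N := fun m => - a m.

Lemma fps_addA : associative (@fps_add K N).
Proof. by move=> a b c; apply/funext => m; apply: addrA. Qed.

Lemma fps_addC : commutative (@fps_add K N).
Proof. by move=> a b; apply/funext => m; apply: addrC. Qed.

Lemma fps_add0 : left_id (@fps_zero K N) (@fps_add K N).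
Proof. by move=> a; apply/funext => m; apply: add0r. Qed.

Lemma fps_addN : left_inverse (@fps_zero K N) fps_opp (@fps_add K N).
Proof. by move=> a; apply/funext => m; apply: addNr. Qed.

Lemma fps_one_neq0 : fps_one <> @fps_zero K N.
Proof.
move=> /(congr1 (fun a => a 0%MM)); rewrite /fps_one /fps_zero eqxx.
exact/eqP/oner_neq0.
Qed.

End SeriesRing.

(** Series are functions, so equality test and choice are taken from classical axioms before the
    ring structure is declared. *)
HB.instance Definition _ (K : comNzRingType) N := gen_eqMixin (fps K N).
HB.instance Definition _ (K : comNzRingType) N := gen_choiceMixin (fps K N).
HB.instance Definition _ (K : comNzRingType) N :=
  GRing.isZmodule.Build (fps K N) (@fps_addA K N) (@fps_addC K N)
    (@fps_add0 K N) (@fps_addN K N).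
HB.instance Definition _ (K : comNzRingType) N :=
  GRing.Zmodule_isComNzRing.Build (fps K N) (@fps_mulA K N) (@fps_mulC K N)
    (@fps_mul1 K N) (@fps_mulDl K N) (introN eqP (@fps_one_neq0 K N)).

Section SeriesTheory.
Variables (K : comNzRingType) (N : nat).
Implicit Types (a b c : fps K N) (p q : {mpoly K[N]}).

Lemma fpsP a b : (forall m, a m = b m) -> a = b.
Proof. exact: funext. Qed.

Lemma fps_addE a b m : (a + b) m = a m + b m. Proof. by []. Qed.
Lemma fps_oppE a m : (- a) m = - a m. Proof. by []. Qed.
Lemma fps_subE a b m : (a - b) m = a m - b m. Proof. by []. Qed.
Lemma fps_0E m : (0 : fps K N) m = 0. Proof. by []. Qed.
Lemma fps_1E m : (1 : fps K N) m = (m == 0%MM)%:R. Proof. by []. Qed.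

Lemma fps_mulE a b m : (a * b) m = fps_mul a b m. Proof. by []. Qed.

Lemma fps_sum_coef (I : Type) (r : seq I) (P : pred I) (F : I -> fps K N) m :
  (\sum_(i <- r | P i) F i) m = \sum_(i <- r | P i) F i m.
Proof. by elim/big_rec2: _ => // i x y _ <-. Qed.

Lemma fps_sumE n (P : pred 'I_n) (F : 'I_n -> fps K N) :
  fps_sum P F = \sum_(i < n | P i) F i.
Proof. by []. Qed.

Lemma fps_powE a k : fps_pow a k = a ^+ k.
Proof. by elim: k => [//|k ih]; rewrite exprS /fps_pow iterS -/(fps_pow _ _) ih. Qed.

Lemma fps_monomE n (g : 'I_n -> fps K N) I :
  fps_monom g I = \prod_(i < n) g i ^+ I i.
Proof. by apply: eq_bigr => i _; apply: fps_powE. Qed.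

Definition fps_mono (m0 : 'X_{1..N}) : fps K N := fun m => (m == m0)%:R.

Lemma fps_mono_mulE m0 a m :
  (fps_mono m0 * a) m = if (m0 <= m)%MM then a (m - m0)%MM else 0.
Proof.
rewrite fps_mulE /fps_mul; case: ifP => le.
  have h1 : (mdeg m0 < (mdeg m).+1)%N.
    by rewrite ltnS -(submK le) mdegD leq_addl.
  have h2 : (mdeg (m - m0) < (mdeg m).+1)%N by rewrite ltnS mdegB.
  rewrite (bigD1 (BMultinom h1, BMultinom h2)) /=; last first.
    by rewrite addmC submK.
  rewrite big1 ?addr0 /fps_mono ?eqxx ?mul1r // => -[k1 k2] /= /andP[/eqP e ne].
  case: eqVneq => [e1|]; last by rewrite mul0r.
  case/negP: ne; apply/eqP; congr (_, _); apply/val_inj => //=.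
  by rewrite [in RHS]e e1 addmC addmK.
apply: big1 => -[k1 k2] /= /eqP e; rewrite /fps_mono.
case: eqVneq => [e1|]; last by rewrite mul0r.
by rewrite -e1 [X in (_ <= X)%MM]e lem_addr in le.
Qed.

Lemma fps_monoM m1 m2 : fps_mono m1 * fps_mono m2 = fps_mono (m1 + m2)%MM.
Proof.
apply/fpsP => m; rewrite fps_mono_mulE /fps_mono; case: ifP => le.
  by congr (_%:R); congr nat_of_bool; rewrite -{2}(submK le) addmC eqm_add2l.
by case: eqVneq => // e; move: le; rewrite e lem_addr.
Qed.

Lemma fps_mono0 : fps_mono 0%MM = 1. Proof. by []. Qed.

Lemma fps_monoX m k : fps_mono m ^+ k = fps_mono (m *+ k)%MM.
Proof.
by elim: k => [|k ih]; rewrite ?expr0 ?mulm0n // exprS ih fps_monoM mulmS.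
Qed.

Lemma fps_varE i : fps_var i = fps_mono U_(i)%MM. Proof. by []. Qed.

Lemma fps_mono_prod n (F : 'I_n -> 'X_{1..N}) :
  \prod_(i < n) fps_mono (F i) = fps_mono (\sum_(i < n) F i)%MM.
Proof. by elim/big_rec2: _ => // i x y _ ->; rewrite fps_monoM. Qed.

Lemma fps_monom_var I : fps_monom fps_var I = fps_mono I.
Proof.
rewrite fps_monomE (eq_bigr (fun i => fps_mono (U_(i) *+ I i)%MM)); last first.
  by move=> i _; rewrite -fps_monoX.
by rewrite fps_mono_prod -multinomUE_id.
Qed.

(** * Orders *)

Lemma Ord_ge0 d : Ord_ge (0 : fps K N) d. Proof. by []. Qed.

Lemma Ord_geD a b d : Ord_ge a d -> Ord_ge b d -> Ord_ge (a + b) d.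
Proof. by move=> ha hb m hm; rewrite fps_addE ha ?hb ?addr0. Qed.

Lemma Ord_geN a d : Ord_ge a d -> Ord_ge (- a) d.
Proof. by move=> ha m hm; rewrite fps_oppE ha ?oppr0. Qed.

Lemma Ord_geB a b d : Ord_ge a d -> Ord_ge b d -> Ord_ge (a - b) d.
Proof. by move=> ha hb; apply: Ord_geD => //; apply: Ord_geN. Qed.

Lemma Ord_geW a d e : (e <= d)%N -> Ord_ge a d -> Ord_ge a e.
Proof. by move=> h ha m hm; apply: ha; apply: leq_trans hm h. Qed.

Lemma Ord_geM a b d e : Ord_ge a d -> Ord_ge b e -> Ord_ge (a * b) (d + e).
Proof.
move=> ha hb m hm; rewrite fps_mulE /fps_mul; apply: big1 => -[k1 k2] /= /eqP em.
case: (ltnP (mdeg k1) d) => h1; first by rewrite ha ?mul0r.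
rewrite hb ?mulr0 //.
by move: (congr1 mdeg em) hm h1; rewrite mdegD; lia.
Qed.

Lemma Ord_ge_sum (I : Type) (r : seq I) (P : pred I) (F : I -> fps K N) d :
  (forall i, P i -> Ord_ge (F i) d) -> Ord_ge (\sum_(i <- r | P i) F i) d.
Proof. by move=> h; elim/big_ind: _ => // *; apply: Ord_geD. Qed.

Lemma Ord_ge_eq0 a : (forall d, Ord_ge a d) -> a = 0.
Proof. by move=> h; apply/fpsP => m; apply: (h (mdeg m).+1). Qed.

Lemma Ord_ge_mono I : Ord_ge (fps_mono I) (mdeg I).
Proof. by move=> m; rewrite /fps_mono; case: eqVneq => // ->; rewrite ltnn. Qed.

Lemma Ord_geX a d k : Ord_ge a d -> Ord_ge (a ^+ k) (d * k).
Proof.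
move=> ha; elim: k => [|k ih]; first by rewrite muln0.
by rewrite exprS mulnS; apply: Ord_geM.
Qed.

Definition wdeg n (w : 'I_n -> nat) (I : 'X_{1..n}) := (\sum_i w i * I i)%N.

Lemma Ord_ge_monom n (w : 'I_n -> nat) (g : 'I_n -> fps K N) I :
  (forall i, Ord_ge (g i) (w i)) -> Ord_ge (fps_monom g I) (wdeg w I).
Proof.
move=> h; rewrite fps_monomE /wdeg; elim/big_rec2: _ => // i x y _ ih.
by apply: Ord_geM => //; apply: Ord_geX.
Qed.

(** By the product rule [a (b - b') + (a - a') b'], agreement [e] orders beyond the leading one
    survives multiplication. *)
Lemma Ord_ge_subM a b a' b' d1 d2 e :
  Ord_ge a d1 -> Ord_ge b' d2 -> Ord_ge (a - a') (d1 + e) ->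
  Ord_ge (b - b') (d2 + e) -> Ord_ge (a * b - a' * b') (d1 + d2 + e).
Proof.
move=> ha hb' hda hdb.
rewrite (_ : _ - _ = a * (b - b') + (a - a') * b'); last by ring.
apply: Ord_geD.
  by rewrite -addnA; apply: Ord_geM.
by rewrite -addnA [(d2 + e)%N]addnC addnA; apply: Ord_geM.
Qed.

Lemma Ord_ge_subX a a' d e k :
  Ord_ge a d -> Ord_ge a' d -> Ord_ge (a - a') (d + e) ->
  Ord_ge (a ^+ k - a' ^+ k) (d * k + e).
Proof.
move=> ha ha' hd; elim: k => [|k ih].
  by rewrite !expr0 subrr.
rewrite !exprS mulnS; apply: Ord_ge_subM => //.
by apply: Ord_geX.
Qed.

Lemma Ord_ge_sub_monom n (w : 'I_n -> nat) (g g' : 'I_n -> fps K N) e I :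
  (forall i, Ord_ge (g i) (w i)) -> (forall i, Ord_ge (g' i) (w i)) ->
  (forall i, Ord_ge (g i - g' i) (w i + e)) ->
  Ord_ge (fps_monom g I - fps_monom g' I) (wdeg w I + e).
Proof.
move=> h h' hd; rewrite !fps_monomE /wdeg.
(* The induction needs an arbitrary list of indices in place of the full enumeration. *)
suff: forall r : seq 'I_n,
  Ord_ge (\prod_(i <- r) g i ^+ I i - \prod_(i <- r) g' i ^+ I i)
    (\sum_(i <- r) w i * I i + e) by apply.
elim=> [|i r ih]; first by rewrite !big_nil subrr.
rewrite !big_cons; apply: Ord_ge_subM => //.
- exact: Ord_geX.
- elim/big_rec2: _ => // j x y _; apply: Ord_geM; exact: Ord_geX.
- exact: Ord_ge_subX.
Qed.

End SeriesTheory.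
Arguments fps_mono {K N} m0.

(** * Composition of formal power series *)

Section Constants.
Variables (K : comNzRingType) (N : nat).

Definition fps_const (x : K) : fps K N := fun m => x * (m == 0%MM)%:R.

Lemma fps_const_mulE x (a : fps K N) m : (fps_const x * a) m = x * a m.
Proof.
rewrite fps_mulE /fps_mul (bigD1 (BMultinom (bm0_proof N (mdeg m)), BMultinom (ltnSn (mdeg m)))) /=;
  last by rewrite add0m.
rewrite big1 ?addr0 /fps_const ?eqxx ?mulr1 // => -[k1 k2] /= /andP[/eqP e ne].
case: eqVneq => [e1|]; last by rewrite mulr0 mul0r.
case/negP: ne; apply/eqP; congr (_, _); apply/val_inj => //=.
by rewrite [in RHS]e e1 add0m.
Qed.

Lemma fps_const_is_additive : additive fps_const.
Proof.
by move=> x y; apply/fpsP => m; rewrite fps_subE /fps_const mulrBl.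
Qed.

Lemma fps_const_is_multiplicative : multiplicative fps_const.
Proof.
split=> [x y|]; apply/fpsP => m.
  by rewrite fps_const_mulE /fps_const mulrA.
by rewrite /fps_const mul1r.
Qed.

HB.instance Definition _ :=
  GRing.isAdditive.Build K (fps K N) fps_const fps_const_is_additive.
HB.instance Definition _ :=
  GRing.isMultiplicative.Build K (fps K N) fps_const fps_const_is_multiplicative.

End Constants.
Arguments fps_const {K N} x.

Lemma wdeg1 n (I : 'X_{1..n}) : wdeg (fun=> 1%N) I = mdeg I.
Proof. by rewrite /wdeg mdegE; apply: eq_bigr => i _; rewrite mul1n. Qed.

Section Composition.
Variables (K : comNzRingType) (n N : nat).
Implicit Types (h p q : fps K n) (g : 'I_n -> fps K N) (P Q : {mpoly K[n]}).

Lemma fps_comp_weight h g (w : 'I_n -> nat) d :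
  (forall I, (wdeg w I < d)%N -> h I = 0) -> (forall i, Ord_ge (g i) (w i)) ->
  Ord_ge (fps_comp h g) d.
Proof.
move=> hh hg m hm; apply: big1 => I _.
case: (ltnP (wdeg w I) d) => hI; first by rewrite hh ?mul0r.
by rewrite (Ord_ge_monom (w := w)) ?mulr0 // (leq_trans hm).
Qed.

(** Monomials of weight below [d] are absent from [h], and each remaining one changes only [e]
    orders beyond its own weight. Used with [w] the weights of (z, w) and with [w] constantly 1. *)
Lemma fps_comp_sub_weight h g g' (w : 'I_n -> nat) d e :
  (forall I, (wdeg w I < d)%N -> h I = 0) ->
  (forall i, Ord_ge (g i) (w i)) -> (forall i, Ord_ge (g' i) (w i)) ->
  (forall i, Ord_ge (g i - g' i) (w i + e)) ->
  Ord_ge (fps_comp h g - fps_comp h g') (d + e).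
Proof.
move=> hh hg hg' hd m hm; rewrite fps_subE -sumrB; apply: big1 => I _.
case: (ltnP (wdeg w I) d) => hI; first by rewrite hh ?mul0r ?subrr.
rewrite -mulrBr -fps_subE (Ord_ge_sub_monom (w := w) (e := e)) ?mulr0 //.
by rewrite (leq_trans hm) // leq_add2r.
Qed.

Lemma fps_compD p q g : fps_comp (p + q) g = fps_comp p g + fps_comp q g.
Proof.
apply/fpsP => m; rewrite fps_addE -big_split /=.
by apply: eq_bigr => I _; rewrite fps_addE mulrDl.
Qed.

Lemma fps_compN p g : fps_comp (- p) g = - fps_comp p g.
Proof.
apply/fpsP => m; rewrite fps_oppE -sumrN.
by apply: eq_bigr => I _; rewrite fps_oppE mulNr.
Qed.

Lemma fps_compB p q g : fps_comp (p - q) g = fps_comp p g - fps_comp q g.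
Proof. by rewrite fps_compD fps_compN. Qed.

Lemma fps_comp0 g : fps_comp 0 g = 0.
Proof. by apply/fpsP => m; apply: big1 => I _; rewrite mul0r. Qed.

Lemma fps_comp_sum (I : Type) (r : seq I) (P : pred I) (F : I -> fps K n) g :
  fps_comp (\sum_(i <- r | P i) F i) g = \sum_(i <- r | P i) fps_comp (F i) g.
Proof.
by elim/big_rec2: _ => [|i x y _ <-]; rewrite ?fps_comp0 // fps_compD.
Qed.

Lemma mmap1_monom g I : mmap1 g I = fps_monom g I.
Proof. by rewrite fps_monomE. Qed.

(** On a truncation, substitution is the evaluation morphism [mmap], from which composition inherits
    its algebraic rules. *)
Lemma fps_comp_trunc h g m : fps_comp h g m = mmap fps_const g (fps_trunc (mdeg m) h) m.
Proof.
rewrite /fps_trunc raddf_sum /= fps_sum_coef; apply: eq_bigr => I _.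
by rewrite mmapZ mmapX mmap1_monom fps_const_mulE.
Qed.

Section NoConstantTerm.
Variable g : 'I_n -> fps K N.
Hypothesis hg : forall i, Ord_ge (g i) 1.

Lemma mmap_Ord d P : (forall I, (mdeg I < d)%N -> P@_I = 0) ->
  Ord_ge (mmap fps_const g P) d.
Proof.
move=> h; apply: Ord_ge_sum => I _ m hm; rewrite mmap1_monom fps_const_mulE.
case: (ltnP (mdeg I) d) => hI; first by rewrite h ?mul0r.
rewrite (Ord_ge_monom (w := fun=> 1%N)) ?mulr0 // wdeg1.
exact: leq_trans hm hI.
Qed.

(** Since [g^I] has order at least |I|, the terms of [P] of degree above |m| are invisible at [m]:
    any polynomial close enough to [h] will do. *)
Lemma fps_comp_mmap d h P m : eq_upto d P h -> (mdeg m <= d)%N ->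
  fps_comp h g m = mmap fps_const g P m.
Proof.
move=> hP hm; rewrite fps_comp_trunc.
apply/eqP; rewrite -subr_eq0 -fps_subE -raddfB /=.
rewrite (@mmap_Ord (mdeg m).+1) // => I hI.
by rewrite mcoeffB fps_truncP // hP ?subrr // (leq_trans _ hm).
Qed.

Lemma fps_compM p q : fps_comp (p * q) g = fps_comp p g * fps_comp q g.
Proof.
apply/fpsP => m; have h x := @fps_truncP K n (mdeg m) x.
rewrite (fps_comp_mmap (eq_uptoM (h p) (h q))) // rmorphM /=.
apply: eq_bigr => -[k1 k2] _ /=.
by congr (_ * _); rewrite (fps_comp_mmap (h _)) // -ltnS bmdeg.
Qed.

Lemma fps_comp_mono I : fps_comp (fps_mono I) g = fps_monom g I.
Proof.
apply/fpsP => m; rewrite (@fps_comp_mmap (mdeg m) _ 'X_[I]) //.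
  by rewrite mmapX mmap1_monom.
by move=> k _; rewrite mcoeffX /fps_mono eq_sym.
Qed.

Lemma fps_comp1 : fps_comp 1 g = 1.
Proof.
by rewrite -fps_mono0 fps_comp_mono fps_monomE big1 // => i _; rewrite mnm0E expr0.
Qed.

Lemma fps_comp_const x : fps_comp (fps_const x) g = fps_const x.
Proof.
apply/fpsP => m; rewrite (@fps_comp_mmap (mdeg m) _ x%:MP) ?mmapC //.
by move=> k _; rewrite mcoeffC.
Qed.

Lemma fps_comp_var i : fps_comp (fps_var i) g = g i.
Proof.
rewrite fps_varE fps_comp_mono fps_monomE (bigD1 i) //= mnm1E eqxx expr1.
by rewrite big1 ?mulr1 // => j ne; rewrite mnm1E eq_sym (negbTE ne) expr0.
Qed.

Lemma fps_compX p k : fps_comp (p ^+ k) g = fps_comp p g ^+ k.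
Proof.
by elim: k => [|k ih]; rewrite ?expr0 ?fps_comp1 // !exprS fps_compM ih.
Qed.

Lemma fps_comp_monom k (f : 'I_k -> fps K n) I :
  fps_comp (fps_monom f I) g = fps_monom (fun i => fps_comp (f i) g) I.
Proof.
rewrite !fps_monomE; elim/big_rec2: _ => [|i x y _ <-]; first exact: fps_comp1.
by rewrite fps_compM fps_compX.
Qed.

End NoConstantTerm.
End Composition.

Lemma fps_comp_ext (K : comNzRingType) (n N : nat) (h : fps K n) (g g' : 'I_n -> fps K N) :
  (forall i, g i = g' i) -> fps_comp h g = fps_comp h g'.
Proof. by move=> e; have -> : g = g' by apply/funext. Qed.

Lemma fps_comp_id (K : comNzRingType) (n : nat) (h : fps K n) : fps_comp h fps_var = h.
Proof.
apply/fpsP => m; rewrite /fps_comp (bigD1 (BMultinom (ltnSn (mdeg m)))) //=.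
rewrite fps_monom_var /fps_mono eqxx mulr1 big1 ?addr0 // => I ne.
rewrite fps_monom_var /fps_mono; case: eqVneq => [e|]; last by rewrite mulr0.
by case/eqP: ne; apply/val_inj.
Qed.

Lemma fps_compA (K : comNzRingType) (n k N : nat) (h : fps K n)
    (f : 'I_n -> fps K k) (g : 'I_k -> fps K N) :
  (forall i, Ord_ge (f i) 1) -> (forall i, Ord_ge (g i) 1) ->
  fps_comp (fps_comp h f) g = fps_comp h (fun i => fps_comp (f i) g).
Proof.
move=> hf hg.
have hfg i : Ord_ge (fps_comp (f i) g) 1.
  by apply: (fps_comp_weight (w := fun=> 1%N)) => // I; rewrite wdeg1; apply: hf.
apply/fpsP => m; have ht := @fps_truncP _ _ (mdeg m) h.
rewrite (fps_comp_mmap hfg ht) //.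
(* At [m] only a truncation of [h] matters, and for a polynomial outer series the claim reduces to
   constants and monomials. *)
rewrite (_ : mmap _ _ _ = fps_comp (mmap fps_const f (fps_trunc (mdeg m) h)) g).
  apply: eq_bigr => I _; congr (_ * _); apply: (fps_comp_mmap hf ht).
  by rewrite -ltnS bmdeg.
rewrite /mmap fps_comp_sum; apply: eq_bigr => I _.
by rewrite fps_compM // fps_comp_const // !mmap1_monom fps_comp_monom.
Qed.

(** The expansion of [phi] cuts the exponents [K] at the degree in (z, \bar z), which exceeds the
    degree in the |z_i|^2 at which a slice is read; the extra terms vanish. *)
Lemma fps_comp_bound (K : comNzRingType) (n N : nat) (h : fps K n)
    (g : 'I_n -> fps K N) D m :
  (forall i, Ord_ge (g i) 1) -> (mdeg m < D)%N ->
  fps_comp h g m = \sum_(I : 'X_{1..n < D}) h I * fps_monom g I m.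
Proof.
case: D => // D hg hm.
rewrite (fps_comp_mmap hg (@fps_truncP _ _ D h)) //.
rewrite /fps_trunc raddf_sum /= fps_sum_coef; apply: eq_bigr => I _.
by rewrite mmapZ mmapX mmap1_monom fps_const_mulE.
Qed.

(** * Exponents of monomials in [z] and [\bar z] *)

Section Exponents.
Variables (n p : nat).
Implicit Types (I : 'X_{1..n}) (J : 'X_{1..p}) (m : 'X_{1..n + p}).

Definition mnm_left m : 'X_{1..n} := [multinom m (lshift p i) | i < n].
Definition mnm_right m : 'X_{1..p} := [multinom m (rshift n i) | i < p].

Lemma mnm_cat_lshift I J i : mnm_cat I J (lshift p i) = I i.
Proof. by rewrite mnmE -/(unsplit (inl i)) unsplitK. Qed.

Lemma mnm_cat_rshift I J i : mnm_cat I J (rshift n i) = J i.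
Proof. by rewrite mnmE -/(unsplit (inr i)) unsplitK. Qed.

Lemma mnm_catK m : mnm_cat (mnm_left m) (mnm_right m) = m.
Proof.
apply/mnmP => i; rewrite -(splitK i); case: (split i) => j /=.
  by rewrite mnm_cat_lshift mnmE.
by rewrite mnm_cat_rshift mnmE.
Qed.

Lemma mnm_left_cat I J : mnm_left (mnm_cat I J) = I.
Proof. by apply/mnmP => i; rewrite mnmE mnm_cat_lshift. Qed.

Lemma mnm_right_cat I J : mnm_right (mnm_cat I J) = J.
Proof. by apply/mnmP => i; rewrite mnmE mnm_cat_rshift. Qed.

Lemma mnm_cat_inj I J I' J' : (mnm_cat I J == mnm_cat I' J') = (I == I') && (J == J').
Proof.
apply/eqP/andP => [e|[/eqP -> /eqP ->] //].
by rewrite -(mnm_left_cat I J) -{2}(mnm_right_cat I J) e mnm_left_cat mnm_right_cat.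
Qed.

Lemma mnm_catD I J I' J' :
  (mnm_cat I J + mnm_cat I' J')%MM = mnm_cat (I + I')%MM (J + J')%MM.
Proof.
apply/mnmP => i; rewrite mnmDE -(splitK i); case: (split i) => j /=.
  by rewrite !mnm_cat_lshift mnmDE.
by rewrite !mnm_cat_rshift mnmDE.
Qed.

Lemma mnm_catB I J I' J' :
  (mnm_cat I J - mnm_cat I' J')%MM = mnm_cat (I - I')%MM (J - J')%MM.
Proof.
apply/mnmP => i; rewrite mnmBE -(splitK i); case: (split i) => j /=.
  by rewrite !mnm_cat_lshift mnmBE.
by rewrite !mnm_cat_rshift mnmBE.
Qed.

Lemma mnm_cat_le I J I' J' :
  (mnm_cat I J <= mnm_cat I' J')%MM = (I <= I')%MM && (J <= J')%MM.
Proof.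
apply/mnm_lepP/andP => [h|[/mnm_lepP h1 /mnm_lepP h2] i].
  split; apply/mnm_lepP => i; first by have := h (lshift p i); rewrite !mnm_cat_lshift.
  by have := h (rshift n i); rewrite !mnm_cat_rshift.
rewrite -(splitK i); case: (split i) => j /=; first by rewrite !mnm_cat_lshift.
by rewrite !mnm_cat_rshift.
Qed.

Lemma mnm_cat00 : mnm_cat 0%MM 0%MM = 0%MM :> 'X_{1..n + p}.
Proof.
apply/mnmP => i; rewrite -(splitK i); case: (split i) => j /=.
  by rewrite mnm_cat_lshift !mnm0E.
by rewrite mnm_cat_rshift !mnm0E.
Qed.

Lemma mdeg_mnm_cat I J : mdeg (mnm_cat I J) = (mdeg I + mdeg J)%N.
Proof.
rewrite !mdegE big_split_ord /=; congr (_ + _)%N; apply: eq_bigr => i _.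
  by rewrite mnm_cat_lshift.
by rewrite mnm_cat_rshift.
Qed.

Lemma mnm_cat_U_left (i : 'I_n) : mnm_cat U_(i)%MM (0%MM : 'X_{1..p}) = U_(lshift p i)%MM.
Proof.
apply/mnmP => k; rewrite -(splitK k) mnm1E; case: (split k) => j /=.
  by rewrite mnm_cat_lshift mnm1E (inj_eq (@lshift_inj n p)).
by rewrite mnm_cat_rshift mnm0E eq_lrshift.
Qed.

Lemma mnm_cat_U_right (i : 'I_p) : mnm_cat (0%MM : 'X_{1..n}) U_(i)%MM = U_(rshift n i)%MM.
Proof.
apply/mnmP => k; rewrite -(splitK k) mnm1E; case: (split k) => j /=.
  by rewrite mnm_cat_lshift mnm0E eq_rlshift.
by rewrite mnm_cat_rshift mnm1E (inj_eq (@rshift_inj n p)).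
Qed.

Lemma mnm_cat_sum k (F : 'I_k -> 'X_{1..n}) (G : 'I_k -> 'X_{1..p}) :
  (\sum_(i < k) mnm_cat (F i) (G i))%MM =
  mnm_cat (\sum_(i < k) F i)%MM (\sum_(i < k) G i)%MM.
Proof.
elim/big_ind3: _ => //; first by rewrite mnm_cat00.
by move=> I J m I' J' m' -> ->; rewrite mnm_catD.
Qed.

End Exponents.

Lemma mnm_catMn n p (I : 'X_{1..n}) (J : 'X_{1..p}) k :
  (mnm_cat I J *+ k)%MM = mnm_cat (I *+ k)%MM (J *+ k)%MM.
Proof.
by elim: k => [|k ih]; rewrite ?mulm0n ?mnm_cat00 // !mulmS ih mnm_catD.
Qed.

Definition mnm_disj n (I J : 'X_{1..n}) := [forall l, (I l * J l)%N == 0%N].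

Section Disjoint.
Variable n : nat.
Implicit Types (I J M : 'X_{1..n}).

Lemma mnm_disjP I J : reflect (forall l, (I l * J l)%N = 0%N) (mnm_disj I J).
Proof. by apply: (iffP forallP) => h l; apply/eqP; apply: h. Qed.

Lemma mnm_disjC I J : mnm_disj I J = mnm_disj J I.
Proof. by apply: eq_forallb => l; rewrite mulnC. Qed.

Lemma mnm_disj0 I : mnm_disj I 0%MM.
Proof. by apply/mnm_disjP => l; rewrite mnm0E muln0. Qed.

(** [M], the coordinatewise minimum of the two halves of [m], is the exponent of the |z_i|^2. *)
Lemma mnm_disj_split (m : 'X_{1..n + n}) :
  exists I J M, mnm_disj I J /\ m = mnm_cat (I + M)%MM (J + M)%MM.
Proof.
pose M := [multinom minn (mnm_left m i) (mnm_right m i) | i < n].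
exists (mnm_left m - M)%MM, (mnm_right m - M)%MM, M; split.
  apply/mnm_disjP => l; rewrite !mnmBE [M l]mnmE.
  by case: (leqP (mnm_left m l)) => h; [have -> : (mnm_left m l - mnm_left m l = 0)%N by lia
    | have -> : (mnm_right m l - mnm_right m l = 0)%N by lia]; rewrite ?muln0 ?mul0n.
by rewrite !submK ?mnm_catK //; apply/mnm_lepP => i; rewrite [M i]mnmE;
  rewrite ?geq_minl ?geq_minr.
Qed.

(** Disjointness makes [M] the coordinatewise minimum of [I + M] and [J + M], so the splitting of an
    exponent is unique. *)
Lemma mnm_disj_inj I J I' J' M M' : mnm_disj I J -> mnm_disj I' J' ->
  (I + M = I' + M')%MM -> (J + M = J' + M')%MM -> I = I' /\ J = J'.
Proof.
move=> /mnm_disjP h /mnm_disjP h' /mnmP e1 /mnmP e2.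
by split; apply/mnmP => l; move: (h l) (h' l) (e1 l) (e2 l); rewrite !mnmDE; nia.
Qed.

End Disjoint.

(** * Slices of series in z and \bar z over disjoint exponents *)

Section Diagonal.
Variables (R : realType) (n : nat).
Local Notation C := R[i].
Implicit Types (I J M : 'X_{1..n}) (p q : fps C n) (a : fps C (n + n)).

Lemma zv_mono (i : 'I_n) : zv R i = fps_mono (mnm_cat U_(i)%MM 0%MM).
Proof. by rewrite mnm_cat_U_left. Qed.

Lemma zbarv_mono (i : 'I_n) : zbarv R i = fps_mono (mnm_cat 0%MM U_(i)%MM).
Proof. by rewrite mnm_cat_U_right. Qed.

Lemma sqmod_mono (i : 'I_n) : sqmod R i = fps_mono (mnm_cat U_(i)%MM U_(i)%MM).
Proof.
have -> : sqmod R i = zv R i * zbarv R i by [].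
by rewrite zv_mono zbarv_mono fps_monoM mnm_catD addm0 add0m.
Qed.

Lemma fps_monom_cat k (F G : 'I_k -> 'X_{1..n}) (I : 'X_{1..k}) :
  fps_monom (fun i => fps_mono (mnm_cat (F i) (G i)) : fps C (n + n)) I =
  fps_mono (mnm_cat (\sum_i F i *+ I i)%MM (\sum_i G i *+ I i)%MM).
Proof.
rewrite fps_monomE -mnm_cat_sum -fps_mono_prod; apply: eq_bigr => i _.
by rewrite fps_monoX mnm_catMn.
Qed.

Lemma sum_mnm0 k (I : 'X_{1..k}) : (\sum_(i < k) 0%MM *+ I i)%MM = 0%MM :> 'X_{1..n}.
Proof.
by rewrite big1 // => i _; apply/mnmP => l; rewrite mulmnE mnm0E.
Qed.

Lemma monom_zv I : fps_monom (@zv R n) I = fps_mono (mnm_cat I 0%MM).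
Proof.
have -> : @zv R n = (fun i => fps_mono (mnm_cat U_(i)%MM 0%MM)).
  by apply/funext => i; apply: zv_mono.
by rewrite fps_monom_cat -multinomUE_id sum_mnm0.
Qed.

Lemma monom_zbarv I : fps_monom (@zbarv R n) I = fps_mono (mnm_cat 0%MM I).
Proof.
have -> : @zbarv R n = (fun i => fps_mono (mnm_cat 0%MM U_(i)%MM)).
  by apply/funext => i; apply: zbarv_mono.
by rewrite fps_monom_cat -multinomUE_id sum_mnm0.
Qed.

Lemma monom_sqmod I : fps_monom (@sqmod R n) I = fps_mono (mnm_cat I I).
Proof.
have -> : @sqmod R n = (fun i => fps_mono (mnm_cat U_(i)%MM U_(i)%MM)).
  by apply/funext => i; apply: sqmod_mono.
by rewrite fps_monom_cat -multinomUE_id.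
Qed.

Lemma Ord_zv (i : 'I_n) : Ord_ge (zv R i) 1.
Proof. by have := @Ord_ge_mono C (n + n) U_(lshift n i)%MM; rewrite mdeg1. Qed.

Lemma Ord_zbarv (i : 'I_n) : Ord_ge (zbarv R i) 1.
Proof. by have := @Ord_ge_mono C (n + n) U_(rshift n i)%MM; rewrite mdeg1. Qed.

Lemma Ord_sqmod (i : 'I_n) : Ord_ge (sqmod R i) 2.
Proof. by apply: (@Ord_geM C (n + n) _ _ 1 1); [apply: Ord_zv | apply: Ord_zbarv]. Qed.

Lemma Ord_sqmod1 (i : 'I_n) : Ord_ge (sqmod R i) 1.
Proof. by apply: Ord_geW (Ord_sqmod i). Qed.

Lemma Ord_sqnorm : Ord_ge (@sqnorm R n) 2.
Proof. by apply: Ord_ge_sum => i _; apply: Ord_sqmod. Qed.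

(** Embeds series in independent variables x_i by x_i = |z_i|^2; the image is supported on exponents
    with equal z and \bar z parts. *)
Definition fps_diag p : fps C (n + n) := fps_comp p (@sqmod R n).

Lemma fps_diagE p I J : fps_diag p (mnm_cat I J) = (I == J)%:R * p I.
Proof.
rewrite /fps_diag /fps_comp.
have hI : (mdeg I < (mdeg (mnm_cat I J)).+1)%N by rewrite mdeg_mnm_cat ltnS leq_addr.
rewrite (bigD1 (BMultinom hI)) //= monom_sqmod {1}/fps_mono mnm_cat_inj eqxx.
rewrite [J == I]eq_sym mulrC big1 ?addr0 // => M ne; rewrite monom_sqmod /fps_mono.
rewrite mnm_cat_inj; case: eqVneq => [e|_]; last by rewrite mulr0.
by case/eqP: ne; apply/val_inj.
Qed.

(* For I, J of disjoint support, the series in the |z_i|^2 multiplying z^I \bar z^J in a. *)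
Definition fps_slice I J a : fps C n := fun M => a (mnm_cat (I + M)%MM (J + M)%MM).

Lemma fps_slice_inj a b :
  (forall I J, mnm_disj I J -> fps_slice I J a = fps_slice I J b) -> a = b.
Proof.
move=> h; apply/fpsP => m; have [I [J [M [hIJ ->]]]] := mnm_disj_split m.
by have /(congr1 (fun s => s M)) := h _ _ hIJ.
Qed.

(** The decoupling of the linear problem: by uniqueness of the splitting of exponents, such a
    product meets one slice only. *)
Lemma fps_slice_mono_diag I J I' J' p : mnm_disj I J -> mnm_disj I' J' ->
  fps_slice I J (fps_mono (mnm_cat I' J') * fps_diag p) =
  if (I' == I) && (J' == J) then p else 0.
Proof.
move=> h h'; apply/fpsP => M; rewrite /fps_slice fps_mono_mulE mnm_cat_le mnm_catB.
rewrite fps_diagE; have [/andP[/eqP -> /eqP ->]|ne] := boolP ((I' == I) && (J' == J)).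
  by rewrite !lem_addr ![(_ + M)%MM]addmC !addmK eqxx mul1r.
case: ifP => [/andP[le1 le2]|//]; case: eqVneq => [e|_]; last by rewrite mul0r.
have [e1 e2] := @mnm_disj_inj _ I J I' J' M (I + M - I')%MM h h'
   (esym (etrans (addmC _ _) (submK le1)))
   (esym (etrans (addmC _ _) (etrans (congr1 (fun x => x + J')%MM e) (submK le2)))).
by move/negP: ne; case; rewrite e1 e2 !eqxx.
Qed.

End Diagonal.

(** * The linear change of variables from [|z_i|^2] to [u, v_2, ..., v_n] *)

Section Homogeneous.
Variables (K : comNzRingType) (N : nat).
Implicit Types (a b : fps K N).

Definition fps_homog a (d : nat) := forall m, mdeg m != d -> a m = 0.

Lemma fps_homogM a b d e : fps_homog a d -> fps_homog b e -> fps_homog (a * b) (d + e).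
Proof.
move=> ha hb m hm; rewrite fps_mulE /fps_mul; apply: big1 => -[k1 k2] /= /eqP em.
case: (eqVneq (mdeg k1) d) => h1; last by rewrite ha ?mul0r.
rewrite hb ?mulr0 //; apply: contra_neq hm => h2.
by rewrite (congr1 mdeg em) mdegD h1 h2.
Qed.

Lemma fps_homogX a d k : fps_homog a d -> fps_homog (a ^+ k) (d * k).
Proof.
move=> ha; elim: k => [|k ih].
  by move=> m; rewrite muln0 mdeg_eq0 expr0 fps_1E => /negbTE ->.
by rewrite exprS mulnS; apply: fps_homogM.
Qed.

Lemma fps_homog_monom n (g : 'I_n -> fps K N) I :
  (forall i, fps_homog (g i) 1) -> fps_homog (fps_monom g I) (mdeg I).
Proof.
move=> h; rewrite fps_monomE mdegE; elim/big_rec2: _ => [m|i x y _ ih].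
  by rewrite mdeg_eq0 fps_1E => /negbTE ->.
by apply: fps_homogM => //; rewrite -[X in fps_homog _ X]mul1n; apply: fps_homogX.
Qed.

End Homogeneous.

Section LinearForms.
Variables (K : comNzRingType) (n : nat).
Implicit Types (A B : 'M[K]_n).

Definition fps_lin A (k : 'I_n) : fps K n := \sum_i fps_const (A k i) * fps_var i.

Lemma fps_homog_lin A k : fps_homog (fps_lin A k) 1.
Proof.
move=> m hm; rewrite /fps_lin fps_sum_coef big1 // => i _; rewrite fps_const_mulE /fps_var.
by case: (eqVneq m U_(i)%MM) => [e|_]; [rewrite e mdeg1 in hm | rewrite mulr0].
Qed.

Lemma Ord_lin A k : Ord_ge (fps_lin A k) 1.
Proof. by move=> m hm; apply: fps_homog_lin; rewrite ltn_eqF. Qed.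

Lemma fps_lin_comp A B k : fps_comp (fps_lin A k) (fps_lin B) = fps_lin (A *m B) k.
Proof.
have hB := Ord_lin B.
rewrite fps_comp_sum /fps_lin.
transitivity (\sum_i \sum_j fps_const (A k i * B i j) * fps_var j : fps K n).
  apply: eq_bigr => i _; rewrite fps_compM // fps_comp_const // fps_comp_var //.
  by rewrite mulr_sumr; apply: eq_bigr => j _; rewrite mulrA -rmorphM.
rewrite exchange_big /=; apply: eq_bigr => j _.
by rewrite -mulr_suml mxE rmorph_sum.
Qed.

Lemma fps_lin1 k : fps_lin 1%:M k = fps_var k.
Proof.
rewrite /fps_lin (bigD1 k) //= !mxE eqxx rmorph1 mul1r big1 ?addr0 // => i ne.
by rewrite mxE eq_sym (negbTE ne) rmorph0 mul0r.
Qed.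

Lemma fps_comp_linK A B (p : fps K n) :
  A *m B = 1%:M -> fps_comp (fps_comp p (fps_lin A)) (fps_lin B) = p.
Proof.
move=> e; rewrite fps_compA; try exact: Ord_lin.
rewrite -[RHS]fps_comp_id; apply: fps_comp_ext => i.
by rewrite fps_lin_comp e fps_lin1.
Qed.

End LinearForms.

Section ChangeOfVariables.
Variables (R : realType) (n : nat).
Hypothesis hn : (1 < n)%N.
Local Notation C := R[i].
Implicit Types (I J M : 'X_{1..n}) (p q : fps C n) (a : fps C (n + n)).

Definition i0 : 'I_n := Ordinal (ltnW hn).

Lemma i0E (i : 'I_n) : (i == i0) = (i == 0%N :> nat).
Proof. by []. Qed.

Lemma e1E : e1 n = U_(i0)%MM.
Proof. by apply/mnmP => i; rewrite mnm1E eq_sym /e1 mnmE. Qed.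

(** Row [k] holds the coefficients of u (for [k = i0]) or of v_k in the |z_i|^2, with indices
    counted from 0. *)
Definition uvmx : 'M[C]_n := \matrix_(k, i)
  if k == i0 then 1 else ((i < k)%N : nat)%:R - (i == k)%:R.

Lemma uvmx_col0 k : uvmx k i0 = 1.
Proof.
rewrite mxE; case: eqVneq => // ne; rewrite subr0.
by rewrite /= lt0n -i0E ne.
Qed.

(** If all the forms vanish at [v], the rows v_k make each entry the sum [S k] of the preceding
    ones, so partial sums double and the total is 2^(n-1) times the first entry. The row u makes
    this total 0. *)
Lemma uvmx_unit : uvmx \in unitmx.
Proof.
rewrite -unitmx_tr -row_free_unit -kermx_eq0; apply/rowV0P => v /sub_kermxP hv.
have hk k : \sum_i v 0 i * uvmx k i = 0.
  have /(congr1 (fun A : 'rV_n => A 0 k)) := hv.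
  rewrite [LHS]mxE [RHS]mxE => e; rewrite -[RHS]e.
  by apply: eq_bigr => i _; rewrite [uvmx^T _ _]mxE.
pose S (k : nat) := \sum_(i < n | (i < k)%N) v 0 i.
have SS (k : 'I_n) : S k.+1 = S k + v 0 k.
  rewrite /S (bigD1 k) //= addrC; congr (_ + _); apply: eq_bigl => i.
  by rewrite ltnS ltn_neqAle andbC.
have hS (k : 'I_n) : k != i0 -> v 0 k = S k.
  move=> ne; have := hk k.
  under eq_bigr => i _ do rewrite mxE (negbTE ne) mulrBr !mulr_natr !mulrb.
  rewrite sumrB -!big_mkcond /= => /eqP; rewrite subr_eq0 => /eqP.
  by rewrite big_pred1_eq => <-.
have S2 k : (k < n)%N -> S k.+1 = 2 ^+ k * v 0 i0.
  elim: k => [|k ih] hk'.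
    rewrite (SS i0) expr0 mul1r /S big1 ?add0r // => i; by rewrite ltn0.
  rewrite (SS (Ordinal hk')) hS //= ih ?(ltnW hk') // exprS; ring.
have v0 : v 0 i0 = 0.
  have := hk i0; under eq_bigr => i _ do rewrite mxE eqxx mulr1.
  move=> hs; have : S n = 0.
    by rewrite -[RHS]hs; apply: eq_bigl => i; rewrite ltn_ord.
  have := S2 n.-1; rewrite (prednK (ltnW hn)) leqnn => -> // /eqP.
  by rewrite mulf_eq0 expf_eq0 pnatr_eq0 andbF /= => /eqP.
apply/rowP => k; rewrite mxE; case: (eqVneq k i0) => [->//|ne].
rewrite hS //; case: k ne => -[|k] hk' // _.
by rewrite S2 ?v0 ?mulr0 // ltnW.
Qed.

(** [to_x] rewrites a series in (u, v_2, ..., v_n) as one in the |z_i|^2, and [to_uv] goes back. *)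
Definition to_x p : fps C n := fps_comp p (fps_lin uvmx).
Definition to_uv p : fps C n := fps_comp p (fps_lin (invmx uvmx)).

Lemma to_xK : cancel to_x to_uv.
Proof. by move=> p; apply: fps_comp_linK; apply: mulmxV uvmx_unit. Qed.

Lemma to_uvK : cancel to_uv to_x.
Proof. by move=> p; apply: fps_comp_linK; apply: mulVmx uvmx_unit. Qed.

Lemma to_uv_Ord p d : Ord_ge p d -> Ord_ge (to_uv p) d.
Proof.
move=> h; apply: (fps_comp_weight (w := fun=> 1%N)).
  by move=> I; rewrite wdeg1; apply: h.
exact: Ord_lin.
Qed.

Lemma to_uv_weight p (a d : nat) : (forall M, (a + 2 * mdeg M < d)%N -> p M = 0) ->
  forall K, (a + 2 * mdeg K < d)%N -> to_uv p K = 0.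
Proof.
move=> h K hK; apply: (to_uv_Ord (d := (mdeg K).+1)) => // M hM; apply: h.
by apply: leq_ltn_trans hK; rewrite leq_add2l leq_mul2l /= -ltnS.
Qed.

Lemma uvE (k : 'I_n) : uv R k = fps_diag (fps_lin uvmx k).
Proof.
rewrite /fps_diag /fps_lin fps_comp_sum /uv -i0E.
have h i : fps_comp (fps_const (uvmx k i) * fps_var i) (@sqmod R n) =
           fps_const (uvmx k i) * sqmod R i.
  rewrite fps_compM ?fps_comp_const ?fps_comp_var // => j; exact: Ord_sqmod1.
under eq_bigr => i _ do rewrite h mxE.
case: ifP => e; first by apply: eq_bigr => i _; rewrite rmorph1 mul1r.
under eq_bigr => i _ do rewrite rmorphB !rmorph_nat mulrBl !mulr_natl !mulrb.
rewrite sumrB -!big_mkcond /=; congr (_ - _).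
by rewrite big_pred1_eq.
Qed.

Lemma monom_uv I : fps_monom (@uv R n) I = fps_diag (fps_monom (fps_lin uvmx) I).
Proof.
have -> : @uv R n = (fun k => fps_diag (fps_lin uvmx k)).
  by apply/funext => k; apply: uvE.
by rewrite /fps_diag fps_comp_monom // => i; apply: Ord_sqmod1.
Qed.

Definition disj_supp (c : 'X_{1..n} -> 'X_{1..n} -> 'X_{1..n} -> C) :=
  forall I J, ~~ mnm_disj I J -> c I J = fun=> 0.

Definition uv_series (c : 'X_{1..n} -> 'X_{1..n} -> 'X_{1..n} -> C) : fps C (n + n) :=
  fun m => \sum_(I : 'X_{1..n < (mdeg m).+1})
      \sum_(J : 'X_{1..n < (mdeg m).+1})
       \sum_(K : 'X_{1..n < (mdeg m).+1})
         c I J K *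
         (fps_monom (@zv R n) I * fps_monom (@zbarv R n) J * fps_monom (@uv R n) K)%F m.

Lemma uv_expansionP phi c :
  is_uv_expansion phi c <-> disj_supp c /\ phi = uv_series c.
Proof.
split=> -[h1 h2]; split=> //.
- move=> I J /forallPn[l /eqP hl]; apply/funext => K; apply: h1; by exists l.
- exact/fpsP.
- move=> I J K [l hl]; rewrite h1 //; apply/negP => /mnm_disjP /(_ l) //.
- by rewrite h2.
Qed.

Lemma uv_term I J p : (fps_monom (@zv R n) I * fps_monom (@zbarv R n) J * fps_diag p)%F =
  fps_mono (mnm_cat I J) * fps_diag p.
Proof.
have -> : forall x y z : fps C (n + n), (x * y * z)%F = x * y * z by [].
by rewrite monom_zv monom_zbarv fps_monoM mnm_catD addm0 add0m.
Qed.

(** Each slice sees a single [c I J]; as [to_x] is invertible, this recovers the coefficients of the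
    expansion from the series. *)
Lemma slice_uv_series c I J : disj_supp c -> mnm_disj I J ->
  fps_slice I J (uv_series c) = to_x (c I J).
Proof.
move=> hc hIJ; apply/fpsP => M; rewrite /fps_slice /uv_series.
set m := mnm_cat _ _.
have hm : mdeg m = (mdeg I + mdeg J + 2 * mdeg M)%N.
  rewrite /m mdeg_mnm_cat !mdegD; lia.
have hI : (mdeg I < (mdeg m).+1)%N by rewrite hm; lia.
have hJ : (mdeg J < (mdeg m).+1)%N by rewrite hm; lia.
have term I' J' K : mnm_disj I' J' ->
  (fps_monom (@zv R n) I' * fps_monom (@zbarv R n) J' * fps_monom (@uv R n) K)%F m =
  (if (I' == I) && (J' == J) then fps_monom (fps_lin uvmx) K else 0) M.
  move=> h; rewrite monom_uv uv_term -(fps_slice_mono_diag _ hIJ h) //.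
have vanish I' J' : (I' != I) || (J' != J) ->
  \sum_(K : 'X_{1..n < (mdeg m).+1}) c I' J' K *
  (fps_monom (@zv R n) I' * fps_monom (@zbarv R n) J' * fps_monom (@uv R n) K)%F m = 0.
  move=> ne; apply: big1 => K _; case: (boolP (mnm_disj I' J')) => h; last first.
    by rewrite hc ?mul0r.
  by rewrite term // -[_ && _]negbK negb_and ne mulr0.
rewrite (bigD1 (BMultinom hI)) //= [X in _ + X]big1 ?addr0; last first.
  move=> I' ne; apply: big1 => J' _; apply: vanish; apply/orP; left.
  by apply: contra_neq ne => e; apply/val_inj.
rewrite (bigD1 (BMultinom hJ)) //= [X in _ + X]big1 ?addr0; last first.
  move=> J' ne; apply: vanish; apply/orP; right.
  by apply: contra_neq ne => e; apply/val_inj.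
rewrite /to_x (@fps_comp_bound _ _ _ _ _ (mdeg m).+1) //; last by rewrite hm; lia.
  by apply: eq_bigr => K _; rewrite term // !eqxx.
exact: Ord_lin.
Qed.

End ChangeOfVariables.

(** * The linearized transformation equation *)

Section Linearization.
Variables (R : realType) (n : nat).
Hypothesis hn : (1 < n)%N.
Local Notation C := R[i].
Local Notation i0 := (i0 hn).
Local Notation uvmx := (uvmx R hn).
Local Notation to_x := (to_x hn).
Local Notation to_uv := (to_uv hn).
Implicit Types (I J M : 'X_{1..n}) (h : fps C (n + 1)) (a : fps C (n + n)).

(* h_(I)(u) as a series in (u, v_2, ..., v_n). *)
Definition u_series h I : fps C n :=
  fun K => if K == (e1 n *+ mdeg K)%MM then zw_coef h I (mdeg K) else 0.

(* h_(I)(u) as a series in the |z_i|^2. *)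
Definition x_series h I : fps C n := to_x (u_series h I).

Definition coef_conj N (h : fps C N) : fps C N := fun m => (h m)^*.

Lemma mdeg_e1 : mdeg (e1 n) = 1%N.
Proof. by rewrite (e1E hn) mdeg1. Qed.

(** u^k is homogeneous of degree k in the |z_i|^2, so only one power of u reaches the exponent
    [B]. *)
Lemma x_seriesE h I B :
  x_series h I B = zw_coef h I (mdeg B) * (fps_lin uvmx i0 ^+ mdeg B) B.
Proof.
rewrite /x_series /to_x /fps_comp.
have hK : (mdeg (e1 n *+ mdeg B)%MM < (mdeg B).+1)%N by rewrite mdegMn mdeg_e1 mul1n.
rewrite (bigD1 (BMultinom hK)) //= big1 ?addr0.
  rewrite /u_series mdegMn mdeg_e1 mul1n eqxx; congr (_ * _).
  rewrite fps_monomE (bigD1 i0) //= mulmnE (e1E hn) mnm1E eqxx mul1n big1 ?mulr1 // => i ne.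
  by rewrite mulmnE mnm1E eq_sym (negbTE ne) mul0n expr0.
move=> K ne; rewrite /u_series; case: eqVneq => e; last by rewrite mul0r.
rewrite (fps_homog_monom (fps_homog_lin uvmx)) ?mulr0 //.
apply: contra_neq ne => h2; apply/val_inj => /=.
by rewrite e -h2.
Qed.

Lemma fps_real_mul N (a b : fps C N) :
  (forall m, (a m)^* = a m) -> (forall m, (b m)^* = b m) ->
  forall m, ((a * b) m)^* = (a * b) m.
Proof.
move=> ha hb m; rewrite fps_mulE /fps_mul rmorph_sum; apply: eq_bigr => k _.
by rewrite rmorphM /= ha hb.
Qed.

Lemma usq_real k m : ((fps_lin uvmx i0 ^+ k) m)^* = (fps_lin uvmx i0 ^+ k) m.
Proof.
elim: k m => [|k ih] m; first by rewrite expr0 fps_1E rmorph_nat.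
rewrite exprS; apply: fps_real_mul => // {}m.
rewrite /fps_lin fps_sum_coef rmorph_sum; apply: eq_bigr => i _.
by rewrite mxE eqxx fps_const_mulE mul1r /fps_var rmorph_nat.
Qed.

Lemma x_series_conj h I M : (x_series h I M)^* = x_series (coef_conj h) I M.
Proof. by rewrite !x_seriesE rmorphM /= usq_real. Qed.

Lemma sqnormE : @sqnorm R n = fps_diag (fps_lin uvmx i0).
Proof. by rewrite -(uvE R hn) /uv. Qed.

Lemma monom_glue (K : comNzRingType) N p q (f : 'I_p -> fps K N) (g : 'I_q -> fps K N) m :
  fps_monom (glue f g) m = fps_monom f (mnm_left m) * fps_monom g (mnm_right m).
Proof.
rewrite !fps_monomE big_split_ord; congr (_ * _); apply: eq_bigr => i _.
  by rewrite /glue -/(unsplit (inl i)) unsplitK mnmE.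
by rewrite /glue -/(unsplit (inr i)) unsplitK mnmE.
Qed.

(** Every power u^k has equal exponents in z and \bar z, so z^I \bar z^J can only come from z^(I -
    J) u^k with k = |J|. *)
Lemma restrict0E h I J : restrict_to 0 h (mnm_cat I J) =
  if (J <= I)%MM then x_series h (I - J)%MM J else 0.
Proof.
rewrite /restrict_to.
have -> : (@sqnorm R n + 0)%F = fps_diag (fps_lin uvmx i0).
  by rewrite -sqnormE; apply: addr0.
have term (m : 'X_{1..n + 1}) :
    fps_monom (glue (@zv R n) (fun=> fps_diag (fps_lin uvmx i0))) m (mnm_cat I J) =
    if (mnm_left m <= I)%MM then
      (I - mnm_left m == J)%MM%:R * (fps_lin uvmx i0 ^+ mnm_right m ord0) J else 0.
  rewrite monom_glue monom_zv fps_monomE big_ord1 /fps_diag.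
  rewrite -fps_compX; last by move=> i; apply: Ord_sqmod1.
  rewrite fps_mono_mulE mnm_cat_le mnm_catB -/(fps_diag _) fps_diagE subm0.
  have -> : (0 <= J)%MM by apply/mnm_lepP => i; rewrite mnm0E.
  by rewrite andbT; case: ifP => // _; case: eqVneq => [->|]; rewrite ?mul0r.
rewrite /fps_comp; case: ifP => le; last first.
  apply: big1 => m _; rewrite term; case: ifP => le'; last by rewrite mulr0.
  case: eqVneq => e; last by rewrite mul0r mulr0.
  by case/negP: (negbT le); rewrite -[X in (X <= _)%MM]e lem_subr.
have hm : (mdeg (mnm_cat (I - J)%MM [multinom mdeg J | _ < 1]) < (mdeg (mnm_cat I J)).+1)%N.
  rewrite !mdeg_mnm_cat [X in (_ + X)%N]mdegE big_ord1 mnmE ltnS leq_add2r.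
  exact: mdegB.
rewrite (bigD1 (BMultinom hm)) //= term mnm_left_cat mnm_right_cat mnmE lem_subr.
have -> : (I - (I - J))%MM = J.
  by apply/mnmP => l; rewrite !mnmBE; have /mnm_lepP/(_ l) := le; lia.
rewrite eqxx mul1r x_seriesE /zw_coef big1 ?addr0 // => m ne; rewrite term.
case: ifP => le'; last by rewrite mulr0.
case: eqVneq => e; last by rewrite mul0r mulr0.
rewrite mul1r (fps_homogX (d := 1)) ?mulr0 //; first exact: fps_homog_lin.
rewrite mul1n; apply: contra_neq ne => hd; apply/val_inj => /=.
rewrite -[RHS]mnm_catK -[LHS]mnm_catK mnm_left_cat mnm_right_cat; congr mnm_cat.
  apply/mnmP => l; move: (congr1 (fun x : 'X_{1..n} => x l) e).
  by rewrite /= !mnmBE; have /mnm_lepP/(_ l) := le'; lia.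
by apply/mnmP => l; rewrite ord1 [RHS]mnmE hd.
Qed.

Lemma slice_restrict0 h I J : mnm_disj I J ->
  fps_slice I J (restrict_to 0 h) = if J == 0%MM then x_series h I else 0.
Proof.
move=> /mnm_disjP hIJ; apply/fpsP => M; rewrite /fps_slice restrict0E.
case: eqVneq => [->|ne]; first by rewrite add0m lem_addl addmK.
case: ifP => // le; case/eqP: ne; apply/mnmP => l; rewrite mnm0E.
by have /mnm_lepP/(_ l) := le; rewrite !mnmDE; move: (hIJ l); nia.
Qed.

(** Either \bar z_i meets a factor z_i and yields |z_i|^2, which stays in a slice with J = 0, or it
    finds none and the slice has J = e_i. *)
Lemma slice_restrict0_zbar h I J i : mnm_disj I J ->
  fps_slice I J (restrict_to 0 h * zbarv R i) =
  (if J == 0%MM then fps_var i * x_series h (I + U_(i))%MM else 0) +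
  (if J == U_(i)%MM then x_series h I else 0).
Proof.
move=> /mnm_disjP hIJ; apply/fpsP => M; rewrite /fps_slice mulrC zbarv_mono fps_mono_mulE.
rewrite mnm_cat_le mnm_catB subm0 restrict0E.
have -> : (0 <= I + M)%MM by apply/mnm_lepP => l; rewrite mnm0E.
rewrite fps_addE /= lep1mP mnmDE.
case: (eqVneq J 0%MM) => [->|neJ].
  rewrite add0m mnm0E add0n [0%MM == _]eq_sym mnm1_eq0 fps_0E addr0 fps_varE fps_mono_mulE lep1mP.
  case: ifP => // nz.
  have -> : (M - U_(i) <= I + M)%MM by apply/mnm_lepP => l; rewrite mnmBE mnmDE; lia.
  congr (x_series h _ _); apply/mnmP => l; rewrite !(mnmBE, mnmDE) mnm1E.
  by case: eqVneq => [<-|_]; lia.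
rewrite fps_0E add0r; case: (eqVneq J U_(i)%MM) => [e|ne].
  have -> : (J + M - U_(i) = M)%MM by rewrite e addmC addmK.
  by rewrite e mnm1E eqxx /= lem_addl addmK.
case: ifP => // nz; case: ifP => // le.
case/eqP: ne; have h0 l : (J l <= (i == l))%N.
  by have /mnm_lepP/(_ l) := le; rewrite !(mnmBE, mnmDE) mnm1E; move: (hIJ l); nia.
apply/mnmP => l; rewrite mnm1E; apply/eqP; rewrite eqn_leq h0 /=.
case: eqVneq => // <-; rewrite lt0n; apply: contra_neq neJ => J0.
apply/mnmP => k; rewrite mnm0E; have := h0 k; case: eqVneq => [<-|_ ]; lia.
Qed.

Lemma slice_conj I J a M : fps_slice I J (fps_conj a) M = (fps_slice J I a M)^*.
Proof.
by rewrite /fps_slice /fps_conj -/(mnm_left _) -/(mnm_right _) mnm_left_cat mnm_right_cat.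
Qed.

Lemma fps_sliceD I J a b : fps_slice I J (a + b) = fps_slice I J a + fps_slice I J b.
Proof. by []. Qed.

Lemma fps_sliceB I J a b : fps_slice I J (a - b) = fps_slice I J a - fps_slice I J b.
Proof. by []. Qed.

Lemma fps_slice_sum k I J (F : 'I_k -> fps C (n + n)) :
  fps_slice I J (\sum_i F i) = \sum_i fps_slice I J (F i).
Proof.
apply/fpsP => M; rewrite /fps_slice !fps_sum_coef.
by apply: eq_bigr.
Qed.

Definition lin_map (f : 'I_n -> fps C (n + 1)) (g : fps C (n + 1)) : fps C (n + n) :=
  restrict_to 0 g - \sum_i (restrict_to 0 (f i) * zbarv R i +
                            fps_conj (restrict_to 0 (f i) * zbarv R i)).

(** |z_i|^2 as a linear form in (u, v_2, ..., v_n). *)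
Definition xlin i := fps_lin (invmx uvmx) i.

(* The z^I \bar z^J part of h(z, u) \bar z_i, in the variables (u, v_2, ..., v_n). *)
Definition half_lin (h : fps C (n + 1)) (i : 'I_n) I J : fps C n :=
  (if J == 0%MM then xlin i * u_series h (I + U_(i))%MM else 0) +
  (if J == U_(i)%MM then u_series h I else 0).

(** The second half is the conjugate term: u and the v_k are real, so conjugation only swaps [I]
    with [J] and conjugates the coefficients of [f i]. *)
Definition lin_uv (f : 'I_n -> fps C (n + 1)) (g : fps C (n + 1)) I J : fps C n :=
  (if J == 0%MM then u_series g I else 0) -
  \sum_i (half_lin (f i) i I J + half_lin (coef_conj (f i)) i J I).

Lemma to_x_xlin i : to_x (xlin i) = fps_var i.
Proof. by rewrite /to_x /xlin fps_lin_comp mulVmx ?uvmx_unit // fps_lin1. Qed.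

Lemma to_x_half_lin h i I J : mnm_disj I J ->
  to_x (half_lin h i I J) = fps_slice I J (restrict_to 0 h * zbarv R i).
Proof.
move=> hIJ; rewrite slice_restrict0_zbar // /to_x fps_compD.
congr (_ + _); case: ifP => _; rewrite ?fps_comp0 //.
rewrite fps_compM; last exact: Ord_lin.
by congr (_ * _); apply: to_x_xlin.
Qed.

Lemma slice_lin_map f g I J : mnm_disj I J ->
  fps_slice I J (lin_map f g) = to_x (lin_uv f g I J).
Proof.
move=> hIJ; have hJI : mnm_disj J I by rewrite mnm_disjC.
rewrite /lin_map fps_sliceB fps_slice_sum slice_restrict0 // /to_x fps_compB fps_comp_sum.
congr (_ - _); first by case: ifP => _ //; rewrite fps_comp0.
apply: eq_bigr => i _; rewrite fps_sliceD fps_compD; congr (_ + _).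
  by rewrite -to_x_half_lin.
apply/fpsP => M; rewrite slice_conj -/(to_x _) to_x_half_lin // !slice_restrict0_zbar //.
rewrite !fps_addE rmorphD; congr (_ + _); case: ifP => _ //; rewrite ?fps_0E ?rmorph0 //.
  rewrite !fps_varE !fps_mono_mulE; case: ifP => _; rewrite ?rmorph0 //.
  by rewrite /= x_series_conj.
by rewrite /= x_series_conj.
Qed.

Lemma u_series_e1 h I k : u_series h I (e1 n *+ k)%MM = zw_coef h I k.
Proof. by rewrite /u_series mdegMn mdeg_e1 mul1n eqxx. Qed.

Lemma u_series_e1U h I k (j : 'I_n) : (0 < j)%N -> u_series h I (e1 n *+ k + U_(j))%MM = 0.
Proof.
move=> hj; rewrite /u_series; case: eqP => // /mnmP /(_ j).
rewrite mnmDE !mulmnE mnm1E eqxx (e1E hn) mnm1E.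
by have -> : (i0 == j) = false by apply/eqP => e; rewrite -e in hj.
Qed.

Lemma xlin_mulE i h I K : (xlin i * u_series h I) K =
  \sum_j invmx uvmx i j * (if (U_(j) <= K)%MM then u_series h I (K - U_(j))%MM else 0).
Proof.
rewrite /xlin /fps_lin mulr_suml fps_sum_coef; apply: eq_bigr => j _.
by rewrite -mulrA fps_const_mulE fps_varE fps_mono_mulE.
Qed.

(** This is why [f] leaves the coefficient of \bar z^I free of u and v untouched. *)
Lemma xlin_mul0 i h I : (xlin i * u_series h I) 0%MM = 0.
Proof.
by rewrite xlin_mulE big1 // => j _; rewrite lep1mP mnm0E eqxx /= mulr0.
Qed.

Lemma xlin_mul_e1 i h I k :
  (xlin i * u_series h I) (e1 n *+ k.+1)%MM = invmx uvmx i i0 * zw_coef h I k.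
Proof.
rewrite xlin_mulE (bigD1 i0) //= big1 ?addr0 => [|j ne].
  rewrite lep1mP mulmnE {1}(e1E hn) mnm1E eqxx /= mulmSr [X in (_ + X)%MM](e1E hn) addmK.
  by rewrite u_series_e1.
by rewrite lep1mP mulmnE (e1E hn) mnm1E [i0 == j]eq_sym (negbTE ne) mul0n eqxx /= mulr0.
Qed.

Lemma xlin_mul_e1U i h I k (j : 'I_n) : (0 < j)%N ->
  (xlin i * u_series h I) (e1 n *+ k + U_(j))%MM = invmx uvmx i j * zw_coef h I k.
Proof.
move=> hj; have nej : (i0 == j) = false by apply/eqP => e; rewrite -e in hj.
rewrite xlin_mulE (bigD1 j) //= big1 ?addr0 => [|l ne].
  by rewrite lem_addl addmK u_series_e1.
rewrite lep1mP mnmDE mulmnE (e1E hn) !mnm1E [j == l]eq_sym (negbTE ne) addn0.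
case: (eqVneq i0 l) => [<-|_] /=; last by rewrite ?mul0n ?eqxx mulr0.
case: k => [|k]; first by rewrite ?muln0 ?eqxx mulr0.
rewrite mulmSr -addmA [(U_(i0) + _)%MM]addmC addmA addmK -(e1E hn).
by rewrite u_series_e1U ?mulr0 //=; case: ifP => _; rewrite mulr0.
Qed.

End Linearization.

(** * Solution of the linearized problem *)

Section LinearSolution.
Variables (R : realType) (n : nat).
Hypothesis hn : (1 < n)%N.
Local Notation C := R[i].
Local Notation i0 := (i0 hn).
Local Notation A := (uvmx R hn).
Local Notation B := (invmx A).
Local Notation xlin := (xlin R hn).
Implicit Types (I J K M : 'X_{1..n}) (h g : fps C (n + 1)) (f : 'I_n -> fps C (n + 1)).

Lemma ne_i0 (j : 'I_n) : (0 < j)%N = (j != i0).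
Proof. by rewrite lt0n. Qed.

(* The exponent of u^{k+1} for j = i0, and of u^k v_j otherwise. *)
Definition ek k (j : 'I_n) : 'X_{1..n} := (e1 n *+ k + U_(j))%MM.

Lemma ek_i0 k : ek k i0 = (e1 n *+ k.+1)%MM.
Proof. by rewrite /ek mulmSr -(e1E hn). Qed.

Lemma mdeg_ek k j : mdeg (ek k j) = k.+1.
Proof. by rewrite /ek mdegD mdeg1 mdegMn (mdeg_e1 hn) mul1n addn1. Qed.

Lemma mdeg_e1k k : mdeg (e1 n *+ k)%MM = k.
Proof. by rewrite mdegMn (mdeg_e1 hn) mul1n. Qed.

Lemma xlin_mul_ek i h I k j :
  (xlin i * u_series h I) (ek k j) = B i j * zw_coef h I k.
Proof.
case: (eqVneq j i0) => [->|ne]; first by rewrite ek_i0 xlin_mul_e1.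
by rewrite xlin_mul_e1U // ne_i0.
Qed.

Lemma u_series_ek h I k j : j != i0 -> u_series h I (ek k j) = 0.
Proof. by move=> ne; rewrite (u_series_e1U hn) // ne_i0. Qed.

(** A system [x *m B = r] on row vectors is solved by [A]: prescribing the n coefficients of u^{k+1}
    and the u^k v_j determines n unknowns. *)
Lemma uvmx_mulC (x r : 'I_n -> C) :
  (forall j, \sum_i B i j * x i = r j) <-> (forall i, x i = \sum_j r j * A j i).
Proof.
pose X : 'rV_n := \row_i x i; pose r' : 'rV_n := \row_i r i.
have e1 : (forall j, \sum_i B i j * x i = r j) <-> X *m B = r'.
  split=> [h|h j].
    apply/rowP => j; rewrite [LHS]mxE [RHS]mxE -h; apply: eq_bigr => i _.
    by rewrite [X _ _]mxE mulrC.
  have := congr1 (fun v : 'rV_n => v 0 j) h; rewrite [LHS]mxE [RHS]mxE => <-.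
  by apply: eq_bigr => i _; rewrite [X _ _]mxE mulrC.
have e2 : (forall i, x i = \sum_j r j * A j i) <-> X = r' *m A.
  split=> [h|h i].
    by apply/rowP => i; rewrite [LHS]mxE h [RHS]mxE; apply: eq_bigr => j _; rewrite [r' _ _]mxE.
  have := congr1 (fun v : 'rV_n => v 0 i) h; rewrite [LHS]mxE [RHS]mxE => ->.
  by apply: eq_bigr => j _; rewrite [r' _ _]mxE.
rewrite e1 e2; split=> [<-|->].
  by rewrite -mulmxA mulVmx ?uvmx_unit // mulmx1.
by rewrite -mulmxA mulmxV ?uvmx_unit // mulmx1.
Qed.

Definition balance (r : 'I_n -> C) (j : 'I_n) : C :=
  if j == i0 then - \sum_(l | l != i0) r l else r j.

(* The rows of [uvmx] all start with 1, so [x i0] is the sum of the entries of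
   [x *m B]; requiring it to vanish fixes the one missing entry. *)
Lemma uvmx_balance (x r : 'I_n -> C) :
  (x i0 = 0 /\ forall j, j != i0 -> \sum_i B i j * x i = r j) <->
  (forall i, x i = \sum_j balance r j * A j i).
Proof.
have sum0 (t : 'I_n -> C) : \sum_j t j * A j i0 = \sum_j t j.
  by apply: eq_bigr => j _; rewrite uvmx_col0 mulr1.
rewrite -uvmx_mulC; split=> [[x0 h] j|h].
  rewrite /balance; case: eqVneq => [->|ne]; last exact: h.
  (* The tautological instance of the inversion expresses [x i0] as the sum of all entries of
     [x *m B]. *)
  have /(_ i0) := (uvmx_mulC x (fun j => \sum_i B i j * x i)).1 (fun=> erefl).
  rewrite x0 sum0 (bigD1 i0) //= => /esym/eqP; rewrite addr_eq0 => /eqP ->.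
  by congr (- _); apply: eq_bigr => l; apply: h.
split=> [|j ne]; last by rewrite h /balance (negbTE ne).
have -> := (uvmx_mulC _ _).1 h i0.
rewrite sum0 (bigD1 i0) //= /balance eqxx addrC; apply/eqP; rewrite subr_eq0; apply/eqP.
by apply: eq_bigr => j /negbTE ->.
Qed.

Lemma uvmx_real j i : (A j i)^* = A j i.
Proof. by rewrite mxE; case: ifP => _; rewrite ?rmorph1 // rmorphB !rmorph_nat. Qed.

Lemma invuvmx_real i j : (B i j)^* = B i j.
Proof.
have e : map_mx Num.conj A = A by apply/matrixP => k l; rewrite mxE uvmx_real.
have := map_invmx (Num.conj : {rmorphism C -> C}) A.
rewrite e => /matrixP /(_ i j); rewrite mxE; exact.
Qed.

Section Coefficients.
Variables (f : 'I_n -> fps C (n + 1)) (g : fps C (n + 1)).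
Hypothesis hf : normalized_map f.

Lemma u_series_f0 i : u_series (f i) 0%MM = 0.
Proof.
case: hf => h _ _ _; apply/fpsP => K; rewrite /u_series; by case: ifP.
Qed.

Lemma u_series_cf0 i : u_series (coef_conj (f i)) 0%MM = 0.
Proof.
case: hf => h _ _ _; apply/fpsP => K; rewrite /u_series; case: ifP => // _.
by rewrite /zw_coef /coef_conj; have := h i (mdeg K); rewrite /zw_coef => ->; rewrite rmorph0.
Qed.

Lemma mnm0U (i : 'I_n) : (0%MM == U_(i)%MM) = false.
Proof. by rewrite eq_sym mnm1_eq0. Qed.

Lemma lin_uv_U I l : I != 0%MM ->
  lin_uv hn f g I U_(l)%MM =
  - u_series (f l) I - \sum_i (if I == U_(i)%MM then u_series (coef_conj (f i)) U_(l)%MM else 0).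
Proof.
move=> ne; rewrite /lin_uv mnm1_eq0 sub0r big_split /= opprD; congr (- _ - _).
  rewrite (bigD1 l) //= /half_lin mnm1_eq0 eqxx add0r big1 ?addr0 // => i ni.
  by rewrite eq_mnm1 eq_sym (negbTE ni) addr0.
by apply: eq_bigr => i _; rewrite /half_lin (negbTE ne) add0r.
Qed.

Lemma lin_uv_00 : lin_uv hn f g 0%MM 0%MM =
  u_series g 0%MM - \sum_i (xlin i * u_series (f i) U_(i)%MM +
                            xlin i * u_series (coef_conj (f i)) U_(i)%MM).
Proof.
rewrite /lin_uv eqxx; congr (_ - _); apply: eq_bigr => i _.
by rewrite /half_lin eqxx mnm0U !addr0 !add0m.
Qed.

(** For [I = e_i] the conjugate half would add f_{i,(0)}, which the normalization removes. *)
Lemma lin_uv_I0 I : I != 0%MM -> lin_uv hn f g I 0%MM =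
  u_series g I - \sum_i xlin i * u_series (f i) (I + U_(i))%MM.
Proof.
move=> ne; rewrite /lin_uv eqxx; congr (_ - _); apply: eq_bigr => i _.
rewrite /half_lin eqxx mnm0U (negbTE ne) addr0 add0r.
by case: ifP; rewrite ?u_series_cf0 addr0.
Qed.

Lemma lin_uv_0I I : I != 0%MM -> lin_uv hn f g 0%MM I =
  - \sum_i xlin i * u_series (coef_conj (f i)) (I + U_(i))%MM.
Proof.
move=> ne; rewrite /lin_uv (negbTE ne) sub0r; congr (- _); apply: eq_bigr => i _.
rewrite /half_lin eqxx mnm0U (negbTE ne) addr0 add0r.
by case: ifP; rewrite ?u_series_f0 add0r.
Qed.

End Coefficients.
End LinearSolution.

(** * The normal form as a system of equations for the coefficients of f and g *)

Section NormalEquations.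
Variables (R : realType) (n : nat).
Hypothesis hn : (1 < n)%N.
Local Notation C := R[i].
Local Notation i0 := (i0 hn).
Local Notation A := (uvmx R hn).
Local Notation B := (invmx A).
Local Notation xlin := (xlin R hn).
Implicit Types (I J K M : 'X_{1..n}).

Definition uv_coefs := 'X_{1..n} -> 'X_{1..n} -> 'X_{1..n} -> C.

Definition wt_ge (d : nat) (c : uv_coefs) :=
  forall I J K, (mdeg I + mdeg J + 2 * mdeg K < d)%N -> c I J K = 0.

(** [gam] stands for the expansion coefficients of the right-hand side of the linear problem. The
    equations are stated for every [k], including the low weights on which [normal_form] is
    silent. *)
Record solves (f : 'I_n -> fps C (n + 1)) (g : fps C (n + 1)) (gam : uv_coefs) : Prop := Solves {
  solves_high : forall h I k, (2 <= mdeg I)%N -> I h = 0%N ->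
    zw_coef (f h) I k = - gam I U_(h)%MM (e1 n *+ k)%MM;
  solves_lin : forall (i j : 'I_n) k, (j < i)%N ->
    zw_coef (f j) U_(i)%MM k = - gam U_(i)%MM U_(j)%MM (e1 n *+ k)%MM;
  solves_resonant : forall I k j, I != 0%MM ->
    \sum_i B i j * (zw_coef (f i) (I + U_(i))%MM k)^* = - gam 0%MM I (ek k j);
  solves_diag : forall k j, j != i0 ->
    \sum_i B i j * zw_coef (f i) U_(i)%MM k = - ('Re (gam 0%MM 0%MM (ek k j)) / 2);
  solves_g0 : forall k, zw_coef g 0%MM k = gam 0%MM 0%MM (e1 n *+ k)%MM +
    if k is k'.+1 then \sum_i B i i0 * (zw_coef (f i) U_(i)%MM k' *+ 2) else 0;
  solves_g : forall I k, I != 0%MM -> zw_coef g I k = gam I 0%MM (e1 n *+ k)%MM +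
    if k is k'.+1 then \sum_i B i i0 * zw_coef (f i) (I + U_(i))%MM k'
    else - (gam 0%MM I 0%MM)^* }.

Variables (f : 'I_n -> fps C (n + 1)) (g : fps C (n + 1)) (gam c : uv_coefs).
Hypothesis hgam : wt_ge 3 gam.
Hypothesis wf : forall i, Ord_wt_ge (f i) 2.
Hypothesis wg : Ord_wt_ge g 3.
Hypothesis hf : normalized_map f.
Hypothesis hc : forall I J K, mnm_disj I J -> c I J K = lin_uv hn f g I J K - gam I J K.

Lemma disjU I (h : 'I_n) : I h = 0%N -> mnm_disj I U_(h)%MM.
Proof.
move=> e; apply/mnm_disjP => l; rewrite mnm1E.
by case: eqVneq => [<-|_]; rewrite ?e ?muln0.
Qed.

Lemma disj0 I : mnm_disj 0%MM I. Proof. by rewrite mnm_disjC mnm_disj0. Qed.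

Lemma coef_high h I k : (2 <= mdeg I)%N -> I h = 0%N ->
  c I U_(h)%MM (e1 n *+ k)%MM =
  - zw_coef (f h) I k - gam I U_(h)%MM (e1 n *+ k)%MM.
Proof.
move=> hI Ih; rewrite hc ?disjU // lin_uv_U //; last first.
  by rewrite -mdeg_eq0; case: (mdeg I) hI.
rewrite big1 ?subr0 ?fps_oppE ?(u_series_e1 hn) // => i _.
by case: eqVneq hI => // ->; rewrite mdeg1.
Qed.

(** The conjugate half brings in f_{i,(e_j)}, zero by normalization for j < i; only f_{j,(e_i)} is
    left to be determined. *)
Lemma coef_lin (i j : 'I_n) k : (j < i)%N ->
  c U_(i)%MM U_(j)%MM (e1 n *+ k)%MM =
  - zw_coef (f j) U_(i)%MM k - gam U_(i)%MM U_(j)%MM (e1 n *+ k)%MM.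
Proof.
move=> hij; have ne : (i == j) = false by apply/eqP => e; rewrite e ltnn in hij.
rewrite hc ?disjU ?mnm1E ?ne // lin_uv_U ?mnm1_eq0 //; congr (_ - _).
rewrite (bigD1 i) //= eqxx big1 ?addr0 => [|l nl]; last first.
  by rewrite eq_mnm1 eq_sym (negbTE nl).
rewrite fps_subE fps_oppE !(u_series_e1 hn) [X in _ - X](_ : _ = 0) ?subr0 //.
case: hf => _ h _ _; have := h _ _ k hij; rewrite /zw_coef /coef_conj => ->.
by rewrite rmorph0.
Qed.

Lemma coef_resonant I k j : I != 0%MM -> c 0%MM I (ek k j) =
  - (\sum_i B i j * (zw_coef (f i) (I + U_(i))%MM k)^*) - gam 0%MM I (ek k j).
Proof.
move=> ne; rewrite hc ?disj0 // lin_uv_0I // fps_oppE fps_sum_coef.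
congr (- _ - _); apply: eq_bigr => i _; exact: xlin_mul_ek.
Qed.

Lemma coef_0I I : I != 0%MM -> c 0%MM I 0%MM = - gam 0%MM I 0%MM.
Proof.
move=> ne; rewrite hc ?disj0 // lin_uv_0I // fps_oppE fps_sum_coef big1 ?oppr0 ?sub0r //.
by move=> i _; apply: xlin_mul0.
Qed.

Lemma diag_real i k : (zw_coef (f i) U_(i)%MM k)^* = zw_coef (f i) U_(i)%MM k.
Proof.
case: hf => _ _ h1 h2; case: (eqVneq i i0) => [->|ne]; first by rewrite h1 // rmorph0.
by apply/CrealP; apply/Creal_ImP; apply: h2; rewrite (ne_i0 hn).
Qed.

Lemma xlin_diag i K k v : (forall h I, (xlin i * u_series h I) K = v * zw_coef h I k) ->
  (xlin i * u_series (f i) U_(i)%MM + xlin i * u_series (coef_conj (f i)) U_(i)%MM) K =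
  v * (zw_coef (f i) U_(i)%MM k *+ 2).
Proof.
move=> h; rewrite fps_addE !h mulr2n mulrDr; congr (_ + _ * _).
exact: diag_real.
Qed.

Lemma coef_diag k j : j != i0 -> c 0%MM 0%MM (ek k j) =
  - (\sum_i B i j * zw_coef (f i) U_(i)%MM k) *+ 2 - gam 0%MM 0%MM (ek k j).
Proof.
move=> ne; rewrite hc ?disj0 // lin_uv_00 fps_subE fps_sum_coef u_series_ek // sub0r.
congr (_ - _); rewrite mulNrn; congr (- _); rewrite -sumrMnl; apply: eq_bigr => i _.
by rewrite (@xlin_diag _ _ k (B i j)) ?mulrnAr // => h I; apply: xlin_mul_ek.
Qed.

Lemma coef_g0 k : c 0%MM 0%MM (e1 n *+ k.+1)%MM = zw_coef g 0%MM k.+1 -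
  \sum_i B i i0 * (zw_coef (f i) U_(i)%MM k *+ 2) - gam 0%MM 0%MM (e1 n *+ k.+1)%MM.
Proof.
rewrite hc ?disj0 // lin_uv_00 fps_subE fps_sum_coef (u_series_e1 hn).
congr (_ - _ - _); apply: eq_bigr => i _.
by rewrite (@xlin_diag _ _ k (B i i0)) // => h I; apply: xlin_mul_e1.
Qed.

Lemma coef_gS I k : I != 0%MM -> c I 0%MM (e1 n *+ k.+1)%MM = zw_coef g I k.+1 -
  \sum_i B i i0 * zw_coef (f i) (I + U_(i))%MM k - gam I 0%MM (e1 n *+ k.+1)%MM.
Proof.
move=> ne; rewrite hc ?mnm_disj0 // lin_uv_I0 // fps_subE fps_sum_coef (u_series_e1 hn).
congr (_ - _ - _); apply: eq_bigr => i _; exact: xlin_mul_e1.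
Qed.

Lemma coef_gI0 I : I != 0%MM -> c I 0%MM 0%MM = zw_coef g I 0 - gam I 0%MM 0%MM.
Proof.
move=> ne; rewrite hc ?mnm_disj0 // lin_uv_I0 // fps_subE fps_sum_coef.
rewrite -[X in u_series _ _ X](mulm0n (e1 n)) (u_series_e1 hn) big1 ?subr0 //.
by move=> i _; apply: xlin_mul0.
Qed.

(** A real f_{i,(e_i)} and its conjugate contribute equally to the (0, 0) slice, hence the factor 2
    and the half of the real part. *)
Lemma Re_opp_half (s x : C) : s^* = s -> 'Re (- s *+ 2 - x) = 0 <-> s = - ('Re x / 2).
Proof.
move=> hs; have h2 : (2 : C) != 0 by rewrite pnatr_eq0.
have -> : 'Re (- s *+ 2 - x) = - (s *+ 2) - 'Re x.
  rewrite raddfB /= mulNrn; congr (_ - _); apply/Creal_ReP.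
  by apply/CrealP; rewrite rmorphN rmorphMn /= hs.
split=> [/eqP|->].
  rewrite subr_eq0 => /eqP <-; rewrite mulNr opprK -(mulr_natr s) mulfK //.
by rewrite -(mulr_natr (- (_ / 2))) mulNr opprK divfK ?subrr.
Qed.

Lemma diag_sum_real k j :
  (\sum_i B i j * zw_coef (f i) U_(i)%MM k)^* = \sum_i B i j * zw_coef (f i) U_(i)%MM k.
Proof.
rewrite rmorph_sum; apply: eq_bigr => i _.
by rewrite rmorphM /= diag_real invuvmx_real.
Qed.

Lemma wfE i I k : (mdeg I + 2 * k < 2)%N -> zw_coef (f i) I k = 0.
Proof. exact: wf. Qed.

(** Equations without a counterpart in [normal_form] occur only in weight at most 2, where [hgam],
    [wf] and [wg] make all terms vanish. *)
Lemma normal_solves : normal_form c -> solves f g gam.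
Proof.
case=> n1 [n2 [n3 [n4 [n5 n6]]]].
have pos I : I != 0%MM -> (1 <= mdeg I)%N by rewrite lt0n mdeg_eq0.
split.
- move=> h I k hI Ih; have := n5 k I h hI Ih.
  by rewrite coef_high // => /eqP; rewrite subr_eq0 => /eqP <-; rewrite opprK.
- move=> i j [|k] hij.
    by rewrite wfE ?mdeg1 // hgam ?oppr0 // !mdeg1 mulm0n mdeg0.
  have := n3 k.+1 i j isT hij.
  by rewrite coef_lin // => /eqP; rewrite subr_eq0 => /eqP <-; rewrite opprK.
- move=> I k j ne; have [_ h1 h2] := n4 _ (pos _ ne).
  have : c 0%MM I (ek k j) = 0.
    case: (eqVneq j i0) => [->|nj]; first by rewrite ek_i0 h1.
    by apply: h2; rewrite (ne_i0 hn).
  by rewrite coef_resonant // => /eqP; rewrite subr_eq0 => /eqP <-; rewrite opprK.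
- move=> [|k] j nj.
    rewrite big1 => [|i _]; last by rewrite wfE ?mulr0 // mdeg1.
    by rewrite hgam ?mdeg0 ?(mdeg_ek hn) // raddf0 mul0r oppr0.
  apply/Re_opp_half; first exact: diag_sum_real.
  by rewrite -coef_diag //; apply: n2; rewrite ?(ne_i0 hn).
- move=> [|[|k]].
  + by rewrite wg ?mdeg0 // hgam ?addr0 // mulm0n !mdeg0.
  + rewrite wg ?mdeg0 // hgam ?add0r ?(mdeg_e1k hn) ?mdeg0 // big1 // => i _.
    by rewrite wfE ?mdeg1 // mul0rn mulr0.
  + have := n1 k.+2 isT; rewrite coef_g0 => /eqP; rewrite subr_eq0 subr_eq => /eqP ->.
    by rewrite addrC.
move=> I [|k] ne.
  (* For |I| > 2 the reality condition equates the (I, 0) coefficient with the conjugate of the (0,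
     I) one, which depends on [gam] alone; this yields g_(I)(0). *)
  case: (ltnP 2 (mdeg I)) => hI.
    have := n6 _ hI; rewrite coef_0I // coef_gI0 // mulm0n => h.
    by rewrite -rmorphN /= h conjCK addrC subrK.
  by rewrite wg ?muln0 ?addn0 // mulm0n !hgam ?mdeg0 ?muln0 ?add0n ?addn0 // rmorph0 oppr0 addr0.
have [h1 _ _] := n4 _ (pos _ ne).
have := h1 k.+1 isT; rewrite coef_gS // => /eqP; rewrite subr_eq0 subr_eq => /eqP ->.
by rewrite addrC.
Qed.

Lemma solves_normal : solves f g gam -> normal_form c.
Proof.
case=> s1 s2 s3 s4 s5 s6.
have pos I : (1 <= mdeg I)%N -> I != 0%MM by rewrite lt0n mdeg_eq0.
split; last split; last split; last split; last split.
- by case=> [//|k] _; rewrite coef_g0 s5 addrK subrr.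
- move=> l i _ hi; have ni : i != i0 by rewrite -(ne_i0 hn).
  by rewrite -/(ek l i) coef_diag //; apply/Re_opp_half; [apply: diag_sum_real | apply: s4].
- by move=> l i j _ hij; rewrite coef_lin // s2 // opprK subrr.
- move=> I /pos ne; split.
  + by case=> [//|k] _; rewrite coef_gS // s6 // addrK subrr.
  + by case=> [//|k] _; rewrite -(ek_i0 hn) coef_resonant // s3 // opprK subrr.
  + by move=> k j hj; rewrite -/(ek k j) coef_resonant // s3 // opprK subrr.
- by move=> k I h hI Ih; rewrite coef_high // s1 // opprK subrr.
move=> I hI; have ne : I != 0%MM by apply: pos; apply: ltn_trans hI.
rewrite coef_0I // coef_gI0 // s6 // mulm0n.
by rewrite [gam I _ _ + _]addrC addrK rmorphN /= conjCK.
Qed.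

End NormalEquations.

(** * Explicit solution of the system, and its weight *)

Section ExplicitSolution.
Variables (R : realType) (n : nat).
Hypothesis hn : (1 < n)%N.
Local Notation C := R[i].
Local Notation i0 := (i0 hn).
Local Notation A := (uvmx R hn).
Local Notation B := (invmx A).
Implicit Types (I J K M : 'X_{1..n}) (gam : uv_coefs R n).

(** The system is homogeneous: a coefficient of [g] of weight w depends on [gam] in weight w, one of
    [f] on [gam] in weight w + 1. The cases for [f] follow whether z_h divides z^I, and then whether
    I = e_h. *)
Lemma solves_weight f g gam d : solves hn f g gam -> normalized_map f -> wt_ge d gam ->
  (forall i, Ord_wt_ge (f i) d.-1) /\ Ord_wt_ge g d.
Proof.
move=> [s1 s2 s3 s4 s5 s6] [h1 h2 h3 h4] hg.
have wf h I k : (mdeg I + 2 * k + 1 < d)%N -> zw_coef (f h) I k = 0.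
  move=> hd; case: (eqVneq (I h) 0%N) => [Ih|Ih].
    case: (ltnP 1 (mdeg I)) => hI.
      by rewrite s1 // hg ?oppr0 // mdeg1 (mdeg_e1k hn); lia.
    case: (eqVneq I 0%MM) => [->|ne]; first exact: h1.
    have /mdeg1P[j /eqP e] : mdeg I == 1%N by rewrite -mdeg_eq0 in ne; lia.
    move: Ih hd; rewrite e mnm1E mdeg1 => /eqP; rewrite eqb0 => nj hd.
    case: (ltngtP j h) => hjh; first exact: h2.
      by rewrite s2 // hg ?oppr0 // !mdeg1 (mdeg_e1k hn); lia.
    by case/eqP: nj; apply/val_inj.
  have hle : (U_(h) <= I)%MM by rewrite lep1mP.
  have dI : mdeg I = (mdeg (I - U_(h)) + 1)%N by rewrite -{1}(submK hle) mdegD mdeg1.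
  rewrite -(submK hle); case: (eqVneq (I - U_(h))%MM 0%MM) => [e|ne].
    rewrite e add0m; have := (uvmx_balance hn (fun i => zw_coef (f i) U_(i)%MM k)
      (fun j => - ('Re (gam 0%MM 0%MM (ek k j)) / 2))).1.
    move=> -> //; last by split=> [|j nj]; [exact: h3 | exact: s4].
    have z j : - ('Re (gam 0%MM 0%MM (ek k j)) / 2) = 0 :> C.
      by rewrite hg ?raddf0 ?mul0r ?oppr0 // !mdeg0 (mdeg_ek hn); lia.
    rewrite big1 // => j _; rewrite /balance z big1 ?oppr0 ?if_same ?mul0r //.
  have := (uvmx_mulC hn (fun i => (zw_coef (f i) (I - U_(h) + U_(i))%MM k)^*)
      (fun j => - gam 0%MM (I - U_(h))%MM (ek k j))).1 (fun j => s3 _ _ _ ne) h.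
  rewrite big1 => [/eqP|j _]; first by rewrite fmorph_eq0 => /eqP.
  by rewrite hg ?oppr0 ?mul0r // mdeg0 (mdeg_ek hn); lia.
split=> [i I k hd|I k hd]; first by apply: wf; lia.
case: (eqVneq I 0%MM) => [eI|ne].
  rewrite eI s5 hg ?add0r; last by rewrite !mdeg0 (mdeg_e1k hn); move: hd; rewrite eI mdeg0.
  case: k hd => // k hd; rewrite big1 // => i _; rewrite wf ?mul0rn ?mulr0 // mdeg1; lia.
rewrite s6 // hg ?add0r; last by rewrite mdeg0 (mdeg_e1k hn) addn0.
case: k hd => [|k] hd; first by rewrite hg ?rmorph0 ?oppr0 // !mdeg0; lia.
by rewrite big1 // => i _; rewrite wf ?mulr0 // mdegD mdeg1; lia.
Qed.

(** The branches mirror [solves], with 0 where the normalization demands it. The last one is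
    conjugated because [solves_resonant] is an equation for conjugates of coefficients of [f]. *)
Definition solution_f gam (h : 'I_n) : fps C (n + 1) := fun m =>
  let I := mnm_left m in let k := mnm_right m ord0 in
  if I h == 0%N then
    if (I == 0%MM) || [exists j : 'I_n, (j < h)%N && (I == U_(j)%MM)] then 0
    else - gam I U_(h)%MM (e1 n *+ k)%MM
  else if (I - U_(h))%MM == 0%MM then
    \sum_j balance hn (fun j => - ('Re (gam 0%MM 0%MM (ek k j)) / 2)) j * A j h
  else (\sum_j (- gam 0%MM (I - U_(h))%MM (ek k j)) * A j h)^*.

Definition solution_g gam : fps C (n + 1) := fun m =>
  let I := mnm_left m in let k := mnm_right m ord0 in
  gam I 0%MM (e1 n *+ k)%MM +
  if I == 0%MM then
    if k is k'.+1 then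
      \sum_i B i i0 * (zw_coef (solution_f gam i) U_(i)%MM k' *+ 2) else 0
  else if k is k'.+1 then
      \sum_i B i i0 * zw_coef (solution_f gam i) (I + U_(i))%MM k'
    else - (gam 0%MM I 0%MM)^*.

Lemma solution_fE gam h I k : zw_coef (solution_f gam h) I k =
  if I h == 0%N then
    if (I == 0%MM) || [exists j : 'I_n, (j < h)%N && (I == U_(j)%MM)] then 0
    else - gam I U_(h)%MM (e1 n *+ k)%MM
  else if (I - U_(h))%MM == 0%MM then
    \sum_j balance hn (fun j => - ('Re (gam 0%MM 0%MM (ek k j)) / 2)) j * A j h
  else (\sum_j (- gam 0%MM (I - U_(h))%MM (ek k j)) * A j h)^*.
Proof. by rewrite /zw_coef /solution_f mnm_left_cat mnm_right_cat mnmE. Qed.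

Lemma solution_f_diag gam i k : zw_coef (solution_f gam i) U_(i)%MM k =
  \sum_j balance hn (fun j => - ('Re (gam 0%MM 0%MM (ek k j)) / 2)) j * A j i.
Proof.
rewrite solution_fE mnm1E eqxx /= (_ : _ - _ = 0)%MM ?eqxx //.
by apply/mnmP => l; rewrite mnmBE subnn mnm0E.
Qed.

Lemma solution_normalized gam : normalized_map (solution_f gam).
Proof.
(* The choice of the entry in [balance] is what gives f_{1,(e_1)} = 0; reality of the other
   f_{i,(e_i)} comes from [A] being real. *)
have bal k := (uvmx_balance hn (fun i => zw_coef (solution_f gam i) U_(i)%MM k)
      (fun j => - ('Re (gam 0%MM 0%MM (ek k j)) / 2))).2 (fun i => solution_f_diag gam i k).
split=> [i k|i j k hij|i k hi|i k hi].
- by rewrite solution_fE mnm0E !eqxx.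
- rewrite solution_fE mnm1E; have -> : (j == i) = false by apply/eqP => e; rewrite e ltnn in hij.
  rewrite eqxx; case: ifP => // /negbT; rewrite negb_or => /andP[_ /existsP[]].
  by exists j; rewrite hij eqxx.
- have -> : i = i0 by apply/val_inj.
  by case: (bal k).
- apply/eqP; rewrite solution_f_diag; apply/eqP/Creal_ImP.
  have hr j : - ('Re (gam 0%MM 0%MM (ek k j)) / 2) \is Num.real.
    by rewrite rpredN rpred_div ?Creal_Re ?realn.
  apply: rpred_sum => j _; apply: rpredM; last by apply/CrealP; apply: uvmx_real.
  rewrite /balance; case: ifP => // _; rewrite rpredN; apply: rpred_sum => l _; exact: hr.
Qed.

Lemma solution_solves gam : solves hn (solution_f gam) (solution_g gam) gam.
Proof.
split.
- move=> h I k hI Ih; rewrite solution_fE Ih eqxx; case: ifP => // /orP[/eqP e|].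
    by rewrite e mdeg0 in hI.
  by case/existsP => j /andP[_ /eqP e]; rewrite e mdeg1 in hI.
- move=> i j k hij; rewrite solution_fE mnm1E.
  have -> : (i == j) = false by apply/eqP => e; rewrite e ltnn in hij.
  rewrite eqxx mnm1_eq0; case: ifP => // /existsP[l /andP[hl]].
  by rewrite eq_mnm1 => /eqP e; move: hl; rewrite -e => h; have := ltn_trans hij h; rewrite ltnn.
- move=> I k j ne; apply: (uvmx_mulC hn _ (fun j => - gam 0%MM I (ek k j))).2 => i.
  rewrite solution_fE mnmDE mnm1E eqxx addn1 /= addmK (negbTE ne) conjCK //.
- move=> k j nj.
  have [_ h] := (uvmx_balance hn (fun i => zw_coef (solution_f gam i) U_(i)%MM k)
      (fun j => - ('Re (gam 0%MM 0%MM (ek k j)) / 2))).2 (fun i => solution_f_diag gam i k).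
  exact: h.
- by move=> k; rewrite {1}/zw_coef /solution_g mnm_left_cat mnm_right_cat mnmE eqxx.
- move=> I k ne.
  by rewrite {1}/zw_coef /solution_g mnm_left_cat mnm_right_cat mnmE (negbTE ne).
Qed.

End ExplicitSolution.

(** * Weight estimates *)

Section WeightEstimates.
Variables (R : realType) (n : nat).
Hypothesis hn : (1 < n)%N.
Local Notation C := R[i].
Implicit Types (I J K M : 'X_{1..n}) (h g : fps C (n + 1)) (f : 'I_n -> fps C (n + 1)).
Implicit Types (a E phi : fps C (n + n)) (c : uv_coefs R n).

Lemma zw_coefE (K : Type) (h : fps K (n + 1)) m :
  h m = zw_coef h (mnm_left m) (mnm_right m ord0).
Proof.
have e : [multinom mnm_right m ord0 | _ < 1] = mnm_right m.
  by apply/mnmP => i; rewrite (ord1 i) [LHS]mnmE.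
by rewrite /zw_coef e mnm_catK.
Qed.

Lemma zw_ext (K : Type) (h h' : fps K (n + 1)) :
  (forall I k, zw_coef h I k = zw_coef h' I k) -> h = h'.
Proof. by move=> e; apply/funext => m; rewrite [LHS]zw_coefE [RHS]zw_coefE e. Qed.

Definition zw_weight (i : 'I_(n + 1)) : nat := glue (fun=> 1%N) (fun=> 2) i.

Lemma wdeg_zw m : wdeg zw_weight m = (mdeg (mnm_left m) + 2 * mnm_right m ord0)%N.
Proof.
rewrite /wdeg big_split_ord big_ord1 mdegE; congr (_ + _)%N.
  apply: eq_bigr => i _; rewrite /zw_weight /glue -/(unsplit (inl i)) unsplitK mul1n.
  by rewrite mnmE.
by rewrite /zw_weight /glue -/(unsplit (inr ord0)) unsplitK mnmE.
Qed.

Lemma Ord_wtP h d : Ord_wt_ge h d -> forall m, (wdeg zw_weight m < d)%N -> h m = 0.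
Proof. by move=> w m; rewrite wdeg_zw => hm; rewrite zw_coefE w. Qed.

Lemma Ord_base E : Ord_ge E 3 -> forall i : 'I_(n + 1),
  Ord_ge (glue (@zv R n) (fun=> (@sqnorm R n + E)%F) i) (zw_weight i).
Proof.
move=> hE i; rewrite /zw_weight /glue; case: (split i) => j; first exact: Ord_zv.
by apply: Ord_geD; [apply: Ord_sqnorm | apply: Ord_geW hE].
Qed.

Lemma restrict_weight E h d : Ord_ge E 3 -> Ord_wt_ge h d -> Ord_ge (restrict_to E h) d.
Proof.
by move=> hE hh; apply: fps_comp_weight (Ord_base hE); apply: Ord_wtP.
Qed.

(** Adding [E] perturbs the argument |z|^2, of order 2, only in order 3, so one order is gained. *)
Lemma restrict_sub0 E h d : Ord_ge E 3 -> Ord_wt_ge h d ->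
  Ord_ge (restrict_to E h - restrict_to 0 h) d.+1.
Proof.
move=> hE hh; rewrite -addn1; apply: (fps_comp_sub_weight (w := zw_weight)).
- exact: Ord_wtP.
- exact: Ord_base.
- by apply: Ord_base; apply: Ord_ge0.
- move=> i; rewrite /zw_weight /glue; case: (split i) => j; first by rewrite subrr.
  rewrite (_ : _ - _ = E) //.
  by apply/fpsP => m; rewrite fps_subE /fps_add fps_0E addr0 addrC addKr.
Qed.

Lemma restrictB E h g : restrict_to E (h - g) = restrict_to E h - restrict_to E g.
Proof. exact: fps_compB. Qed.

Lemma restrictD E h g : restrict_to E (h + g) = restrict_to E h + restrict_to E g.
Proof. exact: fps_compD. Qed.

Lemma Ord_base1 E : Ord_ge E 3 -> forall i : 'I_(n + 1),
  Ord_ge (glue (@zv R n) (fun=> (@sqnorm R n + E)%F) i) 1.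
Proof.
move=> hE i; apply: (Ord_geW _ (@Ord_base E hE i)).
by rewrite /zw_weight /glue; case: (split i).
Qed.

Lemma restrict_z E (i : 'I_n) : Ord_ge E 3 -> restrict_to E (fps_var (lshift 1 i)) = zv R i.
Proof.
move=> hE; rewrite /restrict_to fps_comp_var; last exact: Ord_base1.
by rewrite /glue -/(unsplit (inl i)) unsplitK.
Qed.

Lemma restrict_w E : Ord_ge E 3 -> restrict_to E (fps_var (rshift n ord0)) = @sqnorm R n + E.
Proof.
move=> hE; rewrite /restrict_to fps_comp_var; last exact: Ord_base1.
by rewrite /glue -/(unsplit (inr ord0)) unsplitK.
Qed.

Lemma fps_conjB a b : fps_conj (a - b) = fps_conj a - fps_conj b.
Proof. by apply/fpsP => m; rewrite fps_subE /fps_conj fps_subE rmorphB. Qed.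

Lemma fps_conjD a b : fps_conj (a + b) = fps_conj a + fps_conj b.
Proof. by apply/fpsP => m; rewrite fps_addE /fps_conj fps_addE rmorphD. Qed.

Lemma fps_conjE a I J : fps_conj a (mnm_cat I J) = (a (mnm_cat J I))^*.
Proof.
by rewrite /fps_conj -/(mnm_left _) -/(mnm_right _) mnm_left_cat mnm_right_cat.
Qed.

Lemma Ord_conj a d : Ord_ge a d -> Ord_ge (fps_conj a) d.
Proof.
move=> h m hm; rewrite -(mnm_catK m) fps_conjE h ?rmorph0 //.
by move: hm; rewrite -{1}(mnm_catK m) !mdeg_mnm_cat addnC.
Qed.

Lemma fps_conj_zv i : fps_conj (zv R i) = zbarv R i :> fps C (n + n).
Proof.
apply/fpsP => m; rewrite zv_mono zbarv_mono -(mnm_catK m) fps_conjE /fps_mono.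
by rewrite !mnm_cat_inj andbC rmorph_nat.
Qed.

Lemma fps_conj_mul_zbarv a i : fps_conj (a * zbarv R i) = fps_conj a * zv R i.
Proof.
apply/fpsP => m; rewrite -(mnm_catK m) fps_conjE mulrC [in RHS]mulrC.
rewrite zbarv_mono zv_mono !fps_mono_mulE !mnm_cat_le !mnm_catB fps_conjE andbC.
by case: ifP => // _; rewrite rmorph0.
Qed.

Lemma lin_map_weight f g d : (0 < d)%N -> (forall i, Ord_wt_ge (f i) d.-1) -> Ord_wt_ge g d ->
  Ord_ge (lin_map f g) d.
Proof.
move=> hd hf hg; apply: Ord_geB; first by apply: restrict_weight => //; apply: Ord_ge0.
apply: Ord_ge_sum => i _.
have h : Ord_ge (restrict_to 0 (f i) * zbarv R i) d.
  rewrite -(prednK hd) -addn1; apply: Ord_geM; last exact: Ord_zbarv.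
  by apply: restrict_weight => //; apply: Ord_ge0.
by apply: Ord_geD => //; apply: Ord_conj.
Qed.

Lemma Ord_uv (k : 'I_n) : Ord_ge (uv R k) 2.
Proof.
rewrite /uv; case: ifP => _; first exact: Ord_sqnorm.
by apply: Ord_geB; [apply: Ord_ge_sum => i _ |]; apply: Ord_sqmod.
Qed.

Lemma uv_series_weight c d : wt_ge d c -> Ord_ge (uv_series c) d.
Proof.
move=> h m hm; apply: big1 => I _; apply: big1 => J _; apply: big1 => K _.
case: (ltnP (mdeg I + mdeg J + 2 * mdeg K) d) => hd; first by rewrite h ?mul0r.
suff o : Ord_ge (fps_monom (@zv R n) I * fps_monom (@zbarv R n) J * fps_monom (@uv R n) K)%F
    (mdeg I + mdeg J + 2 * mdeg K).
  by rewrite o ?mulr0 // (leq_trans hm).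
apply: Ord_geM; first apply: Ord_geM.
- by rewrite -(wdeg1 I); apply: Ord_ge_monom; apply: Ord_zv.
- by rewrite -(wdeg1 J); apply: Ord_ge_monom; apply: Ord_zbarv.
- have -> : (2 * mdeg K)%N = wdeg (fun=> 2) K by rewrite /wdeg mdegE big_distrr.
  exact: Ord_ge_monom Ord_uv.
Qed.

Lemma slice_weight a d I J M : Ord_ge a d ->
  (mdeg I + mdeg J + 2 * mdeg M < d)%N -> fps_slice I J a M = 0.
Proof. by move=> h hd; apply: h; rewrite mdeg_mnm_cat !mdegD; lia. Qed.

Lemma to_uv_slice_weight a d I J K : Ord_ge a d ->
  (mdeg I + mdeg J + 2 * mdeg K < d)%N -> to_uv hn (fps_slice I J a) K = 0.
Proof.
move=> h hK; apply: (@to_uv_weight R n hn (fps_slice I J a) (mdeg I + mdeg J) d) hK => M.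
exact: slice_weight.
Qed.

(** No cancellation hides low weights: each [c I J] is recovered from a slice, and [to_uv] preserves
    the order. *)
Lemma uv_series_wtP c d : disj_supp c -> Ord_ge (uv_series c) d -> wt_ge d c.
Proof.
move=> hc hd I J K hK; case: (boolP (mnm_disj I J)) => hIJ; last by rewrite hc.
by rewrite -[c I J](to_xK hn) -(slice_uv_series hn hc hIJ) (to_uv_slice_weight hd).
Qed.

Definition uv_sub c c' : uv_coefs R n := fun I J K => c I J K - c' I J K.

Lemma uv_seriesB c c' : uv_series (uv_sub c c') = uv_series c - uv_series c'.
Proof.
apply/fpsP => m; rewrite fps_subE /uv_series.
do 3! (rewrite -sumrB; apply: eq_bigr => ? _).
by rewrite mulrBl.
Qed.

(** * The defect of the transformation equation *)

Definition defect E f g phi : fps C (n + n) :=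
  let FM i := restrict_to E (fps_var (lshift 1 i) + f i)%F in
  let FMbar i := fps_conj (FM i) in
  restrict_to E (fps_var (rshift n ord0) + g)%F -
    (fps_sum predT (fun i => FM i * FMbar i) + fps_comp phi (glue FM FMbar))%F.

Lemma transformsP E f g phi :
  transforms E (fun i => fps_var (lshift 1 i) + f i)%F (fps_var (rshift n ord0) + g)%F phi
  <-> defect E f g phi = 0.
Proof. by split=> [e|/eqP]; [rewrite /defect e; apply: subrr | rewrite subr_eq0 => /eqP]. Qed.

Lemma defect0 E : Ord_ge E 3 -> defect E (fun=> 0) 0 0 = E.
Proof.
move=> hE; rewrite /defect fps_comp0.
have e (h : fps C (n + 1)) : (h + 0)%F = h by apply: addr0.
rewrite e restrict_w // fps_sumE.
have -> : \sum_(i < n) (restrict_to E (fps_var (lshift 1 i) + 0)%F *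
    fps_conj (restrict_to E (fps_var (lshift 1 i) + 0)%F))%F = @sqnorm R n.
  by apply: eq_bigr => i _; rewrite e restrict_z // fps_conj_zv.
have -> : (@sqnorm R n + 0)%F = @sqnorm R n by apply: addr0.
by rewrite addrC addKr.
Qed.

Lemma glue_zv : glue (@zv R n) (@zbarv R n) = fps_var.
Proof.
by apply/funext => i; rewrite -{2}(splitK i) /glue; case: (split i).
Qed.

(** One order is gained at each place where the equation departs from its linear part: [E] is of
    order 3, the [f] parts are of weight 2, and [phi'] is of order 3. *)
Lemma defect_linearize E f f' g g' phi phi' d :
  Ord_ge E 3 -> (3 <= d)%N ->
  (forall i, Ord_wt_ge (f i) 2) -> (forall i, Ord_wt_ge (f' i) 2) -> Ord_ge phi' 3 ->
  (forall i, Ord_wt_ge (f i - f' i) d.-1) -> Ord_wt_ge (g - g') d -> Ord_ge (phi - phi') d ->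
  Ord_ge (defect E f g phi - defect E f' g' phi' -
    (lin_map (fun i => f i - f' i) (g - g') - (phi - phi'))) d.+1.
Proof.
move=> hE hd wf wf' hphi' hf hg hphi; rewrite /defect /lin_map.
set F := fun i => restrict_to E (fps_var (lshift 1 i) + f i)%F.
set F' := fun i => restrict_to E (fps_var (lshift 1 i) + f' i)%F.
have FE i : F i = zv R i + restrict_to E (f i) by rewrite -(restrict_z i hE) -restrictD.
have FE' i : F' i = zv R i + restrict_to E (f' i) by rewrite -(restrict_z i hE) -restrictD.
have FF i : F i - F' i = restrict_to E (f i - f' i) by rewrite FE FE' restrictB; ring.
have d1 : d = d.-1.+1 by rewrite prednK // (leq_trans _ hd).
have oF i : Ord_ge (F i - F' i) d.-1 by rewrite FF; apply: restrict_weight.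
have o2 i : Ord_ge (restrict_to E (f i)) 2 by apply: restrict_weight.
have o2' i : Ord_ge (restrict_to E (f' i)) 2 by apply: restrict_weight.
rewrite !fps_sumE.
(* Regroups the error into the parts due to [g], to the products F \bar F and to [phi]. *)
have -> : forall x y x' y' u u' s t v : fps C (n + n),
    x - (y + u)%F - (x' - (y' + u')%F) - (s - t - v) =
    (x - x' - s) - (y - y' - t) - (u - u' - v).
  move=> x y x' y' u u' s t v.
  have e (a b : fps C (n + n)) : (a + b)%F = a + b by [].
  by rewrite !e; ring.
apply: Ord_geB; first apply: Ord_geB.
- rewrite -restrictB (_ : _ - _ = g - g'); first exact: restrict_sub0.
  have e (a b : fps C (n + 1)) : (a + b)%F = a + b by [].
  by rewrite !e; ring.
- rewrite -!sumrB; apply: Ord_ge_sum => i _.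
  have -> : (F i * fps_conj (F i))%F = F i * fps_conj (F i) by [].
  have -> : (F' i * fps_conj (F' i))%F = F' i * fps_conj (F' i) by [].
  set D := F i - F' i; set e := restrict_to 0 _.
  rewrite fps_conj_mul_zbarv.
  have De : Ord_ge (D - e) d by rewrite /D FF d1; apply: restrict_sub0.
  (* The first and third terms multiply a difference of order d - 1 by a factor of order 2; the
     other two measure the replacement of [E] by 0. *)
  rewrite (_ : _ - _ = D * (fps_conj (F i) - zbarv R i) + (D - e) * zbarv R i +
     ((F' i - zv R i) * fps_conj D + zv R i * fps_conj (D - e))); last first.
    by rewrite /D !fps_conjB; ring.
  have r2 i' : Ord_ge (F' i' - zv R i') 2 by rewrite FE' addrC addKr.
  have dd : d.+1 = (d.-1 + 2)%N by lia.
  apply: Ord_geD; apply: Ord_geD.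
  + rewrite dd; apply: Ord_geM; first exact: oF.
    by rewrite FE fps_conjD fps_conj_zv addrC addKr; apply: Ord_conj.
  + by rewrite -addn1; apply: Ord_geM => //; apply: Ord_zbarv.
  + by rewrite dd addnC; apply: Ord_geM => //; apply: Ord_conj; apply: oF.
  + by rewrite -add1n; apply: Ord_geM; [apply: Ord_zv | apply: Ord_conj].
have w1 i (G : fps C (n + 1)) : Ord_wt_ge G 2 ->
    Ord_ge (restrict_to E (fps_var (lshift 1 i) + G)%F) 1.
  move=> hG; rewrite restrictD restrict_z //; apply: Ord_geD; first exact: Ord_zv.
  by apply: (Ord_geW _ (restrict_weight hE hG)).
have og (H : 'I_n -> fps C (n + n)) i : (forall j, Ord_ge (H j) 1) ->
    Ord_ge (glue H (fun j => fps_conj (H j)) i) 1.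
  by move=> h; rewrite /glue; case: (split i) => j //; apply: Ord_conj.
have FEg i : Ord_ge (glue F (fun j => fps_conj (F j)) i) 1 by apply: og => j; apply: w1.
have FEg' i : Ord_ge (glue F' (fun j => fps_conj (F' j)) i) 1 by apply: og => j; apply: w1.
set G := glue F _; set G' := glue F' _.
(* Here [fps_var] stands for (z, \bar z), so what remains are displacements of the arguments: from
   (z, \bar z) to [G], and from [G'] to [G]. *)
rewrite (_ : _ - _ = (fps_comp (phi - phi') G - fps_comp (phi - phi') fps_var) +
   (fps_comp phi' G - fps_comp phi' G')); last first.
  by rewrite fps_comp_id fps_compB; ring.
apply: Ord_geD.
  rewrite -addn1; apply: (fps_comp_sub_weight (w := fun=> 1%N)) => //.
  + by move=> I; rewrite wdeg1; apply: hphi.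
  + by rewrite -glue_zv => i; rewrite /glue; case: (split i) => j;
      [apply: Ord_zv | apply: Ord_zbarv].
  + rewrite -glue_zv => i; rewrite /G /glue; case: (split i) => j.
      by rewrite FE addrC addKr.
    by rewrite -/(F j) FE fps_conjD fps_conj_zv addrC addKr; apply: Ord_conj.
(* The arguments have order 1 and differ in order d - 1, that is d - 2 beyond; [phi'] starts in
   degree 3. *)
rewrite (_ : d.+1 = 3 + (d - 2))%N; last by lia.
apply: (fps_comp_sub_weight (w := fun=> 1%N)) => //.
  by move=> I; rewrite wdeg1; apply: hphi'.
move=> i; rewrite (_ : 1 + _ = d.-1)%N; last by lia.
rewrite /G /G' /glue; case: (split i) => j; first exact: oF.
by rewrite -fps_conjB; apply: Ord_conj (oF j).
Qed.

End WeightEstimates.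

(** * Admissible triples and the solution of the equation *)

Section Admissible.
Variables (R : realType) (n : nat).
Hypothesis hn : (1 < n)%N.
Local Notation C := R[i].
Implicit Types (I J K M : 'X_{1..n}).

(* phi is carried by its coefficients tc in the expansion in z, \bar z, u, v,
   on which the normal form is a family of coordinate conditions. *)
Record triple := Triple {
  tf : 'I_n -> fps C (n + 1); tg : fps C (n + 1); tc : uv_coefs R n }.
Implicit Types X Y : triple.

Definition tsub X Y : triple :=
  Triple (fun i => tf X i - tf Y i) (tg X - tg Y) (uv_sub (tc X) (tc Y)).

Definition tadd X Y : triple :=
  Triple (fun i => tf X i + tf Y i) (tg X + tg Y)
         (fun I J K => tc X I J K + tc Y I J K).

Definition triple_ge d X :=
  [/\ forall i, Ord_wt_ge (tf X i) d.-1, Ord_wt_ge (tg X) d & wt_ge d (tc X)].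

Definition admissible X :=
  [/\ triple_ge 3 X, normalized_map (tf X), disj_supp (tc X) & normal_form (tc X)].

(** All conditions are linear over the reals, because ['Re], ['Im] and conjugation are additive. *)
Lemma admissible_sub X Y : admissible X -> admissible Y -> admissible (tsub X Y).
Proof.
case: X => f g c; case: Y => f' g' c'; rewrite /tsub /=.
case=> -[/= a1 a2 a3] [b1 b2 b3 b4] hc [c1 [c2 [c3 [c4 [c5 c6]]]]].
case=> -[/= a1' a2' a3'] [b1' b2' b3' b4'] hc' [c1' [c2' [c3' [c4' [c5' c6']]]]].
have z (h h' : fps C (n + 1)) I k : zw_coef (h - h') I k = zw_coef h I k - zw_coef h' I k by [].
rewrite /uv_sub; split=> /=.
- split=> /= [i I k h|I k h|I J K h]; first by rewrite z a1 ?a1' ?subrr.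
    by rewrite z a2 ?a2' ?subrr.
  by rewrite /uv_sub a3 ?a3' ?subrr.
- split=> [i k|i j k h|i k h|i k h]; rewrite z.
  + by rewrite b1 b1' subrr.
  + by rewrite b2 ?b2' ?subrr.
  + by rewrite b3 ?b3' ?subrr.
  + by rewrite raddfB /= b4 ?b4' ?subrr.
- by move=> I J h; apply/funext => K; rewrite hc ?hc' ?subrr.
split; last split; last split; last split; last split.
- by move=> t h; rewrite c1 ?c1' ?subrr.
- by move=> l i h h'; rewrite raddfB /= c2 ?c2' ?subrr.
- by move=> l i j h h'; rewrite c3 ?c3' ?subrr.
- move=> I hI; have [d1 d2 d3] := c4 _ hI; have [d1' d2' d3'] := c4' _ hI.
  split=> [l h|l h|k j h]; first by rewrite d1 ?d1' ?subrr.
    by rewrite d2 ?d2' ?subrr.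
  by rewrite d3 ?d3' ?subrr.
- by move=> k I h h1 h2; rewrite c5 ?c5' ?subrr.
- by move=> I hI; rewrite c6 ?c6' // rmorphB.
Qed.

Definition tzero : triple := Triple (fun=> 0) 0 (fun _ _ _ => 0).

Lemma admissible0 : admissible tzero.
Proof.
split; rewrite /tzero /=.
- by split.
- by split=> * //=; rewrite raddf0.
- by [].
split; first by [].
split; first by move=> *; rewrite raddf0.
by do !split=> //; move=> *; rewrite rmorph0.
Qed.

Lemma tsubK X Y : tsub (tadd X Y) X = Y.
Proof.
case: X => f g c; case: Y => f' g' c'; rewrite /tsub /tadd /=; congr Triple.
- by apply/funext => i; rewrite addrC addKr.
- by rewrite addrC addKr.
by do 3! apply/funext => ?; rewrite /uv_sub addrC addKr.
Qed.

Lemma tadd_subN X Y : tadd X Y = tsub X (tsub tzero Y).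
Proof.
case: X => f g c; case: Y => f' g' c'; rewrite /tsub /tadd /=; congr Triple.
- by apply/funext => i; rewrite sub0r opprK.
- by rewrite sub0r opprK.
by do 3! apply/funext => ?; rewrite /uv_sub sub0r opprK.
Qed.

Lemma admissible_add X Y : admissible X -> admissible Y -> admissible (tadd X Y).
Proof.
move=> hX hY; rewrite tadd_subN; apply: admissible_sub => //.
by apply: admissible_sub => //; apply: admissible0.
Qed.

Definition tlin X : fps C (n + n) := lin_map (tf X) (tg X) - uv_series (tc X).

Lemma tlin_weight X d : (0 < d)%N -> triple_ge d X -> Ord_ge (tlin X) d.
Proof.
move=> hd [h1 h2 h3]; apply: Ord_geB; first exact: lin_map_weight.
exact: uv_series_weight.
Qed.

Lemma slice_tlin X I J : disj_supp (tc X) -> mnm_disj I J ->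
  fps_slice I J (tlin X) = to_x hn (lin_uv hn (tf X) (tg X) I J - (tc X I J : fps C n)).
Proof.
move=> hX hIJ; rewrite /tlin fps_sliceB (slice_lin_map hn) // (slice_uv_series hn) //.
by rewrite /to_x -fps_compB.
Qed.

Lemma tlin_onto a : Ord_ge a 3 -> exists X, admissible X /\ tlin X = a.
Proof.
move=> ha; pose gam : uv_coefs R n := fun I J => to_uv hn (fps_slice I J a).
have hgam : wt_ge 3 gam by move=> I J K; apply: to_uv_slice_weight.
pose f := solution_f hn gam; pose g := solution_g hn gam.
(* [phi] is what is left over, so the equation holds by construction; the default 0 enforces
   disjoint supports. *)
pose c : uv_coefs R n := fun I J K =>
  if mnm_disj I J then (lin_uv hn f g I J - (gam I J : fps C n)) K else 0.
have hc I J K : mnm_disj I J -> c I J K = lin_uv hn f g I J K - gam I J K.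
  by rewrite /c => ->.
have sc : disj_supp c by move=> I J /negbTE h; apply/funext => K; rewrite /c h.
have hf := solution_normalized hn gam.
have hs := solution_solves hn gam.
have [wf wg] := solves_weight hs hf hgam.
have e : tlin (Triple f g c) = a.
  apply: fps_slice_inj => I J hIJ; rewrite slice_tlin //= -[RHS](to_uvK hn).
  congr (to_x hn _); apply/fpsP => K; rewrite fps_subE hc //.
  by rewrite opprB addrC subrK.
exists (Triple f g c); split=> //; split=> //=.
  split=> //=; apply: (uv_series_wtP hn) => //.
  rewrite (_ : uv_series c = lin_map f g - a).
    by apply: Ord_geB => //; apply: lin_map_weight.
  by rewrite -e /tlin /= opprB addrC subrK.
exact: (solves_normal hf hc).
Qed.

(** Injectivity in quantitative form: [X] solves the system whose data [gam] are the coefficients of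
    [tlin X], so it inherits their weight. *)
Lemma tlin_weight_inv X d : (3 <= d)%N -> admissible X -> Ord_ge (tlin X) d -> triple_ge d X.
Proof.
move=> hd [[w1 w2 w3] hf hs hN] ho.
pose gam : uv_coefs R n := fun I J => to_uv hn (fps_slice I J (tlin X)).
have hgd : wt_ge d gam by move=> I J K; apply: to_uv_slice_weight.
have hg3 : wt_ge 3 gam by move=> I J K h; apply: hgd; apply: leq_trans h hd.
have hc I J K : mnm_disj I J ->
    tc X I J K = lin_uv hn (tf X) (tg X) I J K - gam I J K.
  by move=> hIJ; rewrite /gam slice_tlin // to_xK fps_subE opprB addrC subrK.
have [wf wg] := solves_weight (normal_solves hg3 w1 w2 hf hc hN) hf hgd.
split=> //; apply: (uv_series_wtP hn) => //.
rewrite (_ : uv_series _ = lin_map (tf X) (tg X) - tlin X).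
  by apply: Ord_geB => //; apply: lin_map_weight => //; apply: leq_trans hd.
by rewrite /tlin opprB addrC subrK.
Qed.

(** * Successive approximation and uniqueness *)

Section Solution.
Variable E : fps C (n + n).
Hypothesis hE : Ord_ge E 3.

Definition tdefect X : fps C (n + n) := defect E (tf X) (tg X) (uv_series (tc X)).

Lemma tdefect_linearize X Y d : (3 <= d)%N -> admissible X -> admissible Y ->
  triple_ge d (tsub X Y) -> Ord_ge (tdefect X - tdefect Y - tlin (tsub X Y)) d.+1.
Proof.
move=> hd [[a1 a2 a3] _ _ _] [[b1 b2 b3] _ _ _] [h1 h2 h3].
rewrite /tlin /tsub /= uv_seriesB; apply: defect_linearize => //.
  exact: uv_series_weight.
by rewrite -uv_seriesB; apply: uv_series_weight.
Qed.

Lemma tdefect0 : tdefect tzero = E.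
Proof.
rewrite /tdefect (_ : uv_series _ = 0) ?defect0 //.
by apply/fpsP => m; do 3! (apply: big1 => ? _); rewrite mul0r.
Qed.

Definition approx d X := admissible X /\ Ord_ge (tdefect X) d.

Lemma approx_step d X : (3 <= d)%N -> approx d X ->
  exists Y, approx d.+1 Y /\ triple_ge d (tsub Y X).
Proof.
move=> hd [hX ho].
(* The correction [Z] cancels the whole current defect to first order. *)
have [Z [hZ eZ]] := tlin_onto (Ord_geN (Ord_geW hd ho)).
have wZ : triple_ge d Z by apply: tlin_weight_inv => //; rewrite eZ; apply: Ord_geN.
have hY := admissible_add hX hZ.
exists (tadd X Z); rewrite tsubK; split=> //; split=> //.
have := @tdefect_linearize (tadd X Z) X d hd hY hX; rewrite tsubK => /(_ wZ).
by rewrite eZ opprK subrK.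
Qed.

(** With both defects zero, the linearization error is [tlin] of the difference up to sign. It has
    one order more than assumed, so the weight of the difference grows without bound. *)
Lemma approx_unique X Y : admissible X -> admissible Y -> tdefect X = 0 -> tdefect Y = 0 ->
  tf X = tf Y /\ tg X = tg Y.
Proof.
move=> hX hY eX eY.
have hXY := admissible_sub hX hY.
have w k : triple_ge k.+3 (tsub X Y).
  elim: k => [|k ih]; first by case: hXY.
  apply: tlin_weight_inv => //.
  have := tdefect_linearize (d := k.+3) isT hX hY ih.
  by rewrite eX eY subrr sub0r => /Ord_geN; rewrite opprK.
split; [apply/funext => i|]; apply: zw_ext => I k; apply/eqP; rewrite -subr_eq0; apply/eqP.
  by have [h _ _] := w (mdeg I + 2 * k)%N; apply: (h i I k) => /=; lia.
by have [_ h _] := w (mdeg I + 2 * k)%N; apply: (h I k); lia.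
Qed.

Lemma approx_start : approx 3 tzero.
Proof. by split; [exact: admissible0 | rewrite tdefect0]. Qed.

(** The subset type carries the invariant along, so that the classical choice of the next step can
    be iterated. *)
Definition approx_next k (X : {X | approx k.+3 X}) : {Y | approx k.+4 Y} :=
  let: exist Y hY := cid (approx_step (d := k.+3) isT (proj2_sig X)) in exist _ Y hY.1.

Fixpoint approx_seq k : {X | approx k.+3 X} :=
  if k is k'.+1 then approx_next (approx_seq k') else exist _ tzero approx_start.

Definition tseq k : triple := proj1_sig (approx_seq k).

Lemma tseq_approx k : approx k.+3 (tseq k).
Proof. exact: proj2_sig. Qed.

Lemma tseq_close k : triple_ge k.+3 (tsub (tseq k.+1) (tseq k)).
Proof. by rewrite /tseq /= /approx_next; case: cid => Y []. Qed.

(** The offset 3 is the order of the initial defect. A coefficient of weight w is final from step w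
    - 2 on, so [j] may lie on either side of [w]. *)
Lemma eventually_const (T : Type) (x : nat -> T) w j :
  (forall l, (w < l.+3)%N -> x l.+1 = x l) -> (w < j.+3)%N -> x j = x w.
Proof.
move=> h hj.
have up b t : (w < b.+3)%N -> x (b + t)%N = x b.
  move=> hb; elim: t => [|t ih]; first by rewrite addn0.
  by rewrite addnS h //; lia.
case: (leqP j w) => hjw; first by rewrite -(subnKC hjw) up.
by rewrite -{1}(subnKC (ltnW hjw)) up //; lia.
Qed.

(* The coefficients of weight w no longer change after step w (step w + 1 for f,
   whose weight is shifted by one in triple_ge). *)
Definition tlimit : triple :=
  Triple (fun i m => tf (tseq (wdeg (@zw_weight n) m).+1) i m)
         (fun m => tg (tseq (wdeg (@zw_weight n) m)) m)
         (fun I J K => tc (tseq (mdeg I + mdeg J + 2 * mdeg K)) I J K).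

Lemma wdeg_cat I k : wdeg (@zw_weight n) (mnm_cat I [multinom k | _ < 1]) = (mdeg I + 2 * k)%N.
Proof. by rewrite wdeg_zw mnm_left_cat mnm_right_cat mnmE. Qed.

Lemma tlimit_close j : triple_ge j.+3 (tsub tlimit (tseq j)).
Proof.
split=> /= [i I k h|I k h|I J K h]; apply/eqP; rewrite subr_eq0; apply/eqP => /=.
- rewrite wdeg_cat; set m := mnm_cat _ _; apply/esym.
  apply: (@eventually_const _ (fun l => tf (tseq l) i m)); last by lia.
  move=> l hl; have [c1 _ _] := tseq_close l; apply/eqP; rewrite -subr_eq0; apply/eqP.
  by apply: (c1 i I k) => /=; lia.
- rewrite wdeg_cat; set m := mnm_cat _ _; apply/esym.
  apply: (@eventually_const _ (fun l => tg (tseq l) m)); last by lia.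
  move=> l hl; have [_ c1 _] := tseq_close l; apply/eqP; rewrite -subr_eq0; apply/eqP.
  by apply: (c1 I k) => /=; lia.
apply/esym; apply: (@eventually_const _ (fun l => tc (tseq l) I J K)); last by lia.
move=> l hl; have [_ _ c1] := tseq_close l; apply/eqP; rewrite -subr_eq0; apply/eqP.
by apply: (c1 I J K) => /=; lia.
Qed.

(** Every condition concerns one coefficient, or two of equal weight in the reality condition on (0,
    I) and (I, 0); these come from one and the same step, which is admissible. *)
Lemma tlimit_admissible : admissible tlimit.
Proof.
have adm k : admissible (tseq k) by case: (tseq_approx k).
split=> /=.
- split=> /= [i I k|I k|I J K].
  + by have [[a _ _] _ _ _] := adm (wdeg (@zw_weight n) (mnm_cat I [multinom k | _ < 1])).+1;
      exact: a.
  + by have [[_ a _] _ _ _] := adm (wdeg (@zw_weight n) (mnm_cat I [multinom k | _ < 1]));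
      exact: a.
  + by have [[_ _ a] _ _ _] := adm (mdeg I + mdeg J + 2 * mdeg K)%N; exact: a.
- have nm k : normalized_map (tf (tseq k)) by case: (adm k).
  split=> [i k|i j k|i k|i k]; rewrite /zw_coef /=.
  + by have [a _ _ _] := nm (wdeg (@zw_weight n)
      (mnm_cat (0%MM : 'X_{1..n}) [multinom k | _ < 1])).+1; exact: a.
  + by have [_ a _ _] := nm (wdeg (@zw_weight n) (mnm_cat U_(j)%MM [multinom k | _ < 1])).+1;
      exact: a.
  + by have [_ _ a _] := nm (wdeg (@zw_weight n) (mnm_cat U_(i)%MM [multinom k | _ < 1])).+1;
      exact: a.
  + by have [_ _ _ a] := nm (wdeg (@zw_weight n) (mnm_cat U_(i)%MM [multinom k | _ < 1])).+1;
      exact: a.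
- move=> I J h; apply/funext => K.
  by have [_ _ a _] := adm (mdeg I + mdeg J + 2 * mdeg K)%N; rewrite a.
have nf k : normal_form (tc (tseq k)) by case: (adm k).
split; first by move=> t; exact: (nf _).1.
split; first by move=> l i; exact: (nf _).2.1.
split; first by move=> l i j; exact: (nf _).2.2.1.
split; last split; last by move=> I hI; rewrite [(mdeg 0 + mdeg I)%N]addnC; exact: (nf _).2.2.2.2.2.
  move=> I hI; split=> [l|l|k j].
  - by have [h _ _] := (nf (mdeg I + mdeg (0 : 'X_{1..n})%MM +
                            2 * mdeg (e1 n *+ l)%MM)%N).2.2.2.1 _ hI; apply: h.
  - by have [_ h _] := (nf (mdeg (0 : 'X_{1..n})%MM + mdeg I +
                            2 * mdeg (e1 n *+ l)%MM)%N).2.2.2.1 _ hI; apply: h.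
  - by have [_ _ h] := (nf (mdeg (0 : 'X_{1..n})%MM + mdeg I +
                            2 * mdeg (e1 n *+ k + U_(j))%MM)%N).2.2.2.1 _ hI; apply: h.
by move=> k I h; exact: (nf _).2.2.2.2.1.
Qed.

Lemma tlimit_defect : tdefect tlimit = 0.
Proof.
apply: Ord_ge_eq0 => d; have [hd od] := tseq_approx d.
have hc := tlimit_close d.
have := tdefect_linearize (d := d.+3) isT tlimit_admissible hd hc => hl.
(* The defect of the limit is the linearization error plus [tlin] of the remaining distance plus the
   defect of step [d], each of order at least d + 3. *)
rewrite -(subrK (tlin (tsub tlimit (tseq d)) + tdefect (tseq d)) (tdefect tlimit)).
apply: (@Ord_geW _ _ _ d.+3); first by lia.
apply: Ord_geD; last by apply: Ord_geD => //; apply: tlin_weight.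
rewrite (_ : _ - _ = tdefect tlimit - tdefect (tseq d) - tlin (tsub tlimit (tseq d))).
  by apply: Ord_geW hl.
by ring.
Qed.

End Solution.
End Admissible.

Theorem theorem2p3 (R : realType) (n : nat) (hn : (2 <= n)%N)
    (E : fps R[i] (n + n)) (hE : Ord_ge E 3) :
  exists! fg : ('I_n -> fps R[i] (n + 1)) * fps R[i] (n + 1),
    let: (f, g) := fg in
    let F i := (fps_var (lshift 1 i) + f i)%F in
    let G := (fps_var (rshift n ord0) + g)%F in
    [/\ forall i, Ord_wt_ge (f i) 2,
        Ord_wt_ge g 3,
        normalized_map f
      & exists phi : fps R[i] (n + n),
          [/\ Ord_ge phi 3,
              transforms E F G phi
            & exists2 c, is_uv_expansion phi c & normal_form c]].
Proof.
have [[wf wg wc] hf hs hN] := tlimit_admissible hn hE.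
exists (tf (tlimit hn hE), tg (tlimit hn hE)); split.
  split=> //; exists (uv_series (tc (tlimit hn hE))); split.
  - exact: uv_series_weight.
  - by apply/transformsP; apply: tlimit_defect.
  by exists (tc (tlimit hn hE)) => //; apply/uv_expansionP.
case=> f g [wf' wg' hf' [phi [ophi tr [c /uv_expansionP[sc ephi] nc]]]].
(* Any competitor becomes an admissible triple once its [phi] is replaced by the coefficients [c],
   which inherit the order of [phi]. *)
have hX : admissible (Triple f g c).
  by split=> //; split=> //=; apply: (uv_series_wtP hn) => //; rewrite -ephi.
have eX : tdefect E (Triple f g c) = 0 by rewrite /tdefect /= -ephi; apply/transformsP.
have [e1 e2] := approx_unique hn hE (tlimit_admissible hn hE) hX (tlimit_defect hn hE) eX.
by rewrite e1 e2.
Qed.
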